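(* Suppose that there exists a nonprincipal discrete ultrafilter on $\omega$. Let $\kappa$ be any cardinal and let $X=\prod_{\alpha<\kappa}X_\alpha$ (with the product topology), where each $X_\alpha$ is a completely regular Hausdorff space satisfying at least one of the following conditions: (i) $X_\alpha$ is an infinite compact $\beta\omega$-space; (ii) $X_\alpha$ contains a weak $P$-point; (iii) $X_\alpha$ has a nonempty sequentially small open subset. Suppose also that at least one $X_\alpha$ is an infinite compact $\beta\omega$-space. Then $X$ is not homogeneous.
   Context: All spaces are completely regular Hausdorff topological spaces. A set is called discrete if it is discrete in the subspace topology (not necessarily closed). An ultrafilter $p$ on $\omega$ is discrete if for any function $f\colon\omega\to\mathbb R$ there is an $A\in p$ such that $f(A)$ is a discrete subspace of $\mathbb R$. A space $X$ is a $\beta\omega$-space if, whenever $D$ is a countable discrete subset of $X$ with compact closure $\overline D$ in $X$, this closure $\overline D$ is the Stone–Čech compactification $\beta D$ of $D$. A point $x\in X$ is a weak $P$-point if $x\notin\overline D$ whenever $D$ is a countable subset of $X\setminus\{x\}$. A space $X$ is sequentially small if any infinite set in $X$ has an infinite subset whose closure does not contain a copy (homeomorphic image) of $\beta\omega$, the Stone–Čech compactification of the countable discrete space $\omega$. A space $X$ is homogeneous if for any $x,y\in X$ there is a homeomorphism of $X$ onto itself taking $x$ to $y$. *)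

(* Defs.v *)
From HB Require Import structures.
From mathcomp Require Import all_boot all_order all_algebra.
From mathcomp Require Import all_classical all_reals all_analysis.

Set Implicit Arguments.
Unset Strict Implicit.
Unset Printing Implicit Defensive.

Import Order.TTheory GRing.Theory Num.Theory.
Import numFieldNormedType.Exports.

Local Open Scope classical_set_scope.

Definition homeomorphism (X Y : topologicalType) (f : X -> Y) : Prop :=
  exists g : Y -> X,
    [/\ cancel f g, cancel g f, continuous f & continuous g].

Definition homogeneous (X : topologicalType) : Prop :=
  forall x y : X, exists f : X -> X, homeomorphism f /\ f x = y.

(* The second clause says that [X] carries the initial topology of [f]. *)
Definition embedding (X Y : topologicalType) (f : X -> Y) : Prop :=
  injective f /\ (@open X) = [set f @^-1` V | V in (@open Y)].

(* [B], together with [e], is the Stone-Cech compactification of [T]: a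
   Hausdorff compactification through which every continuous map from [T] to
   a compact Hausdorff space factors. Such a factorization is unique, since
   [e] has dense range. *)
Definition is_stone_cech (T B : topologicalType) (e : T -> B) : Prop :=
  [/\ embedding e, dense (range e),
      compact [set: B], hausdorff_space B &
      forall (K : topologicalType) (f : T -> K),
        compact [set: K] -> hausdorff_space K -> continuous f ->
        exists g : B -> K, continuous g /\ forall t, g (e t) = f t].

Definition discrete_set (X : topologicalType) (D : set X) : Prop :=
  forall U : set (set_type D), open U.

Definition nonprincipal (T : Type) (p : set_system T) : Prop :=
  forall t : T, p <> principal_filter t.

Definition discrete_ultrafilter (R : realType) (p : set_system nat) : Prop :=
  UltraFilter p /\
  forall f : nat -> R, exists A : set nat, p A /\ discrete_set (f @` A).

Definition closure_incl (X : topologicalType) (D : set X) (x : set_type D) :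
    set_type (closure D) :=
  exist _ (set_val x) (mem_set (subset_closure (set_valP x))).

(* The identification of [closure D] with the Stone-Cech compactification of
   [D] fixes [D] pointwise. Finite sets [D] are allowed; for them the
   condition holds in every T1 space. *)
Definition beta_omega_space (X : topologicalType) : Prop :=
  forall D : set X, countable D -> discrete_set D -> compact (closure D) ->
    is_stone_cech (@closure_incl X D).

Definition weak_P_point (X : topologicalType) (x : X) : Prop :=
  forall D : set X, countable D -> D `<=` [set~ x] -> ~ closure D x.

Definition contains_copy_of_beta_omega (X : topologicalType) (C : set X) :
    Prop :=
  exists (B : topologicalType) (e : nat -> B) (h : B -> X),
    [/\ is_stone_cech e, embedding h & range h `<=` C].

Definition sequentially_small (X : topologicalType) : Prop :=
  forall A : set X, infinite_set A ->
    exists B : set X, [/\ B `<=` A, infinite_set B &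
                          ~ contains_copy_of_beta_omega (closure B)].

Definition infinite_compact_beta_omega_space (X : topologicalType) : Prop :=
  [/\ infinite_set [set: X], compact [set: X] & beta_omega_space X].

(* [U] is sequentially small as a space, so the closures of its subsets are
   taken in [U]. *)
Definition has_sequentially_small_open (X : topologicalType) : Prop :=
  exists U : set X, [/\ open U, U !=set0 & sequentially_small (set_type U)].

(* Main.v *)
Require Import Defs.
From HB Require Import structures.
From mathcomp Require Import all_boot all_order all_algebra.
From mathcomp Require Import all_classical all_reals all_analysis.
From mathcomp Require Import lra.

(* Let q be a nonprincipal discrete ultrafilter. Kunen's method gives a weak
   P-point r on a countable set that is not an image of q. In an infinite compact
   beta-omega-space the r-limit of a discrete sequence is then the q-limit of no
   nontrivial sequence, exactly as for a weak P-point. Let x be a point of the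
   product whose coordinates are of this kind, or lie in sequentially small open
   sets, and let y differ from x only in one beta-omega-coordinate i0, where it is
   the q-limit of points e n lying in disjoint open sets W n. Suppose that a
   homeomorphism f maps y to x, and let x_n be the image of the point obtained
   from y by replacing its i0-th coordinate with e n; thus x is the q-limit of
   x_n. The f-images of the neighbourhoods given by the W n involve countably many
   coordinates only, and the other coordinates of x_n may be replaced by those of
   x. By a diagonal argument there is an infinite set of indices along which every
   one of these countably many coordinates of x_n is either eventually constant or
   has a closure containing no copy of beta omega. The i0-th coordinates of the
   preimages under f stay in the disjoint sets W n, so the x_n form a copy of omega
   with closure beta omega in a countable product of spaces containing no copy of
   beta omega, contrary to a theorem of Malykhin. *)

Set Implicit Arguments.
Unset Strict Implicit.
Unset Printing Implicit Defensive.

Import Order.TTheory GRing.Theory Num.Theory.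
Import numFieldNormedType.Exports.

Local Open Scope classical_set_scope.

(** * Sets of cardinality less than the continuum *)

Notation branch := (nat -> bool).

Definition row_of (x : branch) (n : nat) : branch :=
  fun m => x (pickle (n, m)).

Lemma row_of_surj (f : nat -> branch) : exists x, row_of x = f.
Proof.
exists (fun k => if unpickle k is Some (n, m) then f n m else false).
by apply/funext => n; apply/funext => m; rewrite /row_of pickleK.
Qed.

Definition nat_of_branch (x : branch) : nat := xget 0%N [set n | x n].

Definition seq_of_branch (x : branch) (n : nat) : nat :=
  nat_of_branch (row_of x n).

Lemma seq_of_branch_surj (f : nat -> nat) : exists x, seq_of_branch x = f.
Proof.
have [x xf] := row_of_surj (fun n m => m == f n).
exists x; apply/funext => n; rewrite /seq_of_branch xf /nat_of_branch.
by case: xgetP => [m _ /= /eqP //|/(_ (f n))]; rewrite /= eqxx.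
Qed.

(* Cardinality less than that of the continuum. *)
Definition small (U : set branch) : Prop :=
  forall h : branch -> branch, exists x, ~ (h @` U) x.

Lemma small_sub (U V : set branch) : U `<=` V -> small V -> small U.
Proof.
by move=> UV sV h; have [x nx] := sV h; exists x => -[u /UV Vu ux]; apply: nx; exists u.
Qed.

Lemma not_small_surj (U : set branch) :
  ~ small U -> exists h : branch -> branch, forall x, (h @` U) x.
Proof.
move=> nU; apply: contrapT => /forallNP nh; apply: nU => h.
by apply: contrapT => /forallNP hx; apply: (nh h) => x; exact: contrapT (hx x).
Qed.

Lemma small_image (g : branch -> branch) (U : set branch) :
  small U -> small (g @` U).
Proof.
move=> sU h; have [x nx] := sU (h \o g); exists x => -[_ [u Uu <-] hx].
by apply: nx; exists u.
Qed.

Lemma small_ex (U : set branch) : small U -> exists x, ~ U x.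
Proof. by move=> /(_ id)[x nx]; exists x => Ux; apply: nx; exists x. Qed.

(* Koenig's diagonal argument. *)
Lemma small_bigcup (U : nat -> set branch) :
  (forall n, small (U n)) -> small (\bigcup_n U n).
Proof.
move=> sU h.
have /choice[t tP] : forall n, exists x, ~ ((fun u => row_of (h u) n) @` U n) x.
  by move=> n; exact: sU.
have [x xt] := row_of_surj t.
by exists x => -[u [n _ Unu] hu]; apply: (tP n); exists u => //; rewrite hu xt.
Qed.

Lemma small0 : small set0.
Proof. by move=> h; exists (fun=> false) => -[]. Qed.

Lemma small1 (x : branch) : small [set x].
Proof.
move=> h; have [e|ne] := pselect (h x = fun=> true).
  by exists (fun=> false) => -[_ -> hx]; move: e; rewrite hx => /(congr1 (@^~ 0%N)).
by exists (fun=> true) => -[_ -> hx]; exact: ne.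
Qed.

Lemma smallU (U V : set branch) : small U -> small V -> small (U `|` V).
Proof.
move=> sU sV; apply: (@small_sub _ (\bigcup_n (if n is 0%N then U else V))).
  by move=> x [Ux|Vx]; [exists 0%N|exists 1%N].
by apply: small_bigcup => -[].
Qed.

Lemma small_seq (s : seq branch) : small [set` s].
Proof.
elim: s => [|x s IHs].
  by apply: small_sub small0 => x.
apply: (small_sub _ (smallU (small1 x) IHs)) => y /=.
by rewrite inE => /orP[/eqP ->|ys]; [left|right].
Qed.

Lemma small_bigcup_seq (U : set branch) (s : branch -> seq branch) :
  small U -> small (\bigcup_(x in U) [set` s x]).
Proof.
move=> sU; apply: (@small_sub _ (\bigcup_n ((fun x => nth x (s x) n) @` U))).
  move=> y [x Ux /= ys]; exists (index y (s x)) => //; exists x => //.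
  by rewrite nth_index.
by apply: small_bigcup => n; exact: small_image.
Qed.

(** The points with a small initial segment stand in for an ordinal of size continuum: if they
    formed a small set, the least point outside it would have a small initial segment as well. *)
Lemma ex_small_well_order : exists lt : branch -> branch -> Prop,
  [/\ well_founded lt, (forall x y z, lt x y -> lt y z -> lt x z),
      (forall x y, [\/ lt x y, x = y | lt y x]) &
      ~ small [set x | small [set y | lt y x]]].
Proof.
have [R Rwo] := wochoice.well_ordering_principle branch.
have Rmin (A : set branch) : A !=set0 -> exists z, A z /\ forall y, A y -> R z y.
  move=> [a Aa]; have [|z [[/asboolP Az minz] _]] := Rwo [pred x | `[< A x >]].
    by exists a; apply/asboolP.
  by exists z; split=> // y Ay; apply: minz; apply/asboolP.
have Rtot x y : R x y || R y x.
  have [|z [[->|->] zP]] := Rmin [set x; y]; first by exists x; left.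
    by rewrite zP//; right.
  by rewrite orbC zP//; left.
have Ranti x y : R x y -> R y x -> x = y.
  move=> xy yx.
  have [|z [_ zu]] := Rwo (pred2 x y); first by exists x; rewrite inE eqxx.
  have Rx u : R u u by have := Rtot u u; rewrite orbb.
  transitivity z; [apply/esym|]; apply: zu; split; rewrite ?inE ?eqxx ?orbT//.
    by move=> u; rewrite !inE => /orP[/eqP->|/eqP->].
  by move=> u; rewrite !inE => /orP[/eqP->|/eqP->].
have Rtr x y z : R x y -> R y z -> R x z.
  move=> xy yz; have [|u [[[->|->]|->] uP]] := Rmin [set x; y; z].
  - by exists x; left; left.
  - by apply: uP; right.
  - have yx : R y x by apply: uP; left; left.
    by rewrite (Ranti _ _ xy yx).
  - have zy : R z y by apply: uP; left; right.
    by rewrite -(Ranti _ _ yz zy).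
pose lt x y := R x y /\ x <> y.
have lt_wf : well_founded lt.
  move=> x; apply: contrapT => nx.
  have [|z [nz zP]] := Rmin [set x | ~ Acc lt x]; first by exists x.
  apply: nz; constructor => y [yz nyz]; apply: contrapT => ny.
  by apply: nyz; apply: Ranti => //; exact: zP.
have lt_tot x y : [\/ lt x y, x = y | lt y x].
  have [->|nxy] := pselect (x = y); first by constructor 2.
  have /orP[xy|yx] := Rtot x y; first by constructor 1.
  by constructor 3; split=> // /esym.
exists lt; split=> //.
  move=> x y z [xy nxy] [yz nyz]; split; first exact: Rtr yz.
  by move=> xz; subst z; apply: nxy; exact: Ranti.
move=> sW; have [x nx] := small_ex sW.
have [|z [nz zP]] := Rmin [set x | ~ small [set y | lt y x]]; first by exists x.
apply: nz; apply: small_sub sW => y [yz nyz] /=; apply: contrapT => ny.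
by apply: nyz; apply: Ranti => //; exact: zP.
Qed.

(** * Weak P-points *)

(** A countable index set for the matrix: a node gives a level [k] and, for the restriction of each
    row index to [k] coordinates, a finite set of restricted column indices. *)
Definition node := {k : nat & {ffun k.-tuple bool -> {set k.-tuple bool}}}.

Definition restr k (x : branch) : k.-tuple bool := [tuple x i | i < k].

(* Kunen's matrix of sets. For fixed [X] the sets [linked X Y n] are increasing
   in [n], and any [n] of them, but no [n + 1], have an infinite intersection. *)
Definition linked (X Y : branch) (n : nat) : set node :=
  [set z : node | (#|projT2 z (restr (projT1 z) X)| <= n)%N /\
           restr (projT1 z) Y \in projT2 z (restr (projT1 z) X)].

(** The finite intersections within row [X] that stay infinite: at most [n] columns at stage [n].
    The empty list of columns gives the whole of [node]. *)
Definition cell (X : branch) : set (set node) :=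
  [set B | exists n (Ys : seq branch), (size Ys <= n)%N /\
     B = [set z | forall Y, Y \in Ys -> linked X Y n z]].

Lemma linkedS X Y m n : (m <= n)%N -> linked X Y m `<=` linked X Y n.
Proof. by move=> mn z [zm zY]; split=> //; exact: leq_trans mn. Qed.

Lemma cell_linked X Y : cell X (linked X Y 1).
Proof.
exists 1%N, [:: Y]; split=> //; apply/seteqP; split=> [z Yz Y'|z]; last first.
  by apply; rewrite mem_head.
by rewrite inE => /eqP ->.
Qed.

Lemma restr_inj (s : seq branch) :
  exists k0, forall k, (k0 <= k)%N -> {in s &, injective (restr k)}.
Proof.
have pair x y : exists k0, forall k, (k0 <= k)%N -> restr k x = restr k y -> x = y.
  have [->|ne] := pselect (x = y); first by exists 0%N.
  have [i xyi] : exists i, x i <> y i.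
    by apply: contrapT => /forallNP xy; apply/ne/funext => i; exact: contrapT (xy i).
  exists i.+1 => k ik e; exfalso; apply: xyi.
  have := congr1 (fun t => tnth t (Ordinal ik)) e.
  by rewrite !tnth_mktuple.
elim: s => [|x s [k0 IHs]]; first by exists 0%N.
have [k1 xk1] : exists k1, forall k y, (k1 <= k)%N -> y \in s ->
    restr k x = restr k y -> x = y.
  elim: s {IHs} => [|y s [k1 IHs]]; first by exists 0%N.
  have [k2 xy] := pair x y; exists (maxn k1 k2) => k z.
  rewrite geq_max => /andP[k1k k2k]; rewrite inE => /orP[/eqP ->|]; first exact: xy.
  exact: IHs.
exists (maxn k0 k1) => k; rewrite geq_max => /andP[k0k k1k] y z.
rewrite !inE => /orP[/eqP ->|ys] /orP[/eqP ->|zs] //.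
- exact: xk1.
- by move=> /esym/(xk1 _ _ k1k ys) ->.
- exact: IHs.
Qed.

Lemma finite_level m : finite_set [set z : node | (projT1 z < m)%N].
Proof.
apply: (@sub_finite_set _ _ (\bigcup_(k in `I_m) range
  (fun f : {ffun k.-tuple bool -> {set k.-tuple bool}} => existT _ k f : node))).
  by move=> [k f] /= km; exists k => //; exists f.
by apply: bigcup_finite; [exact: finite_II|move=> k _; exact/finite_image/finite_finset].
Qed.

Lemma finite_bounded_level (A : set node) :
  finite_set A -> exists m, forall z, A z -> (projT1 z < m)%N.
Proof.
move=> /finite_seqP[s ->]; exists (\max_(z <- s) projT1 z).+1 => z /= zs.
by rewrite ltnS; exact: (@leq_bigmax_seq _ s xpredT (fun z => projT1 z)).
Qed.

(** At a level where the restrictions of [Ys] are distinct, they would be [n.+1] elements of a set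
    of at most [n]; only the finitely many nodes of lower level remain. *)
Lemma linked_finite X n (Ys : seq branch) : uniq Ys -> size Ys = n.+1 ->
  finite_set [set z | forall Y, Y \in Ys -> linked X Y n z].
Proof.
move=> uY sY; have [k0 inj] := restr_inj Ys.
apply: sub_finite_set (finite_level k0) => z /= zY; rewrite ltnNge.
apply/negP => /inj {}inj.
have : (size Ys <= n)%N.
  have [Y0 Y0s] : exists Y, Y \in Ys.
    by case: Ys sY {uY inj zY} => // Y; exists Y; rewrite mem_head.
  apply: leq_trans (zY _ Y0s).1; rewrite -(size_map (restr (projT1 z))).
  have /card_uniqP <- : uniq (map (restr (projT1 z)) Ys) by rewrite map_inj_in_uniq.
  by apply/subset_leq_card/fintype.subsetP => _ /mapP[Y Ys_Y ->]; exact: (zY _ Ys_Y).2.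
by rewrite sY ltnn.
Qed.

(** At a level that separates the rows in [Xs], a node may prescribe the finite set of columns for
    each row separately. *)
Lemma cells_meet (Xs : seq branch) (c : branch -> set node) m :
  (forall X, cell X (c X)) ->
  exists z : node, (m <= projT1 z)%N /\ forall X, X \in Xs -> c X z.
Proof.
move=> /choice[n /choice[Ys cP]]; have [k0 inj] := restr_inj Xs.
pose k := maxn k0 m; have {}inj := inj k (leq_maxl _ _).
pose row u := nth (fun=> false) Xs (find (fun X => restr k X == u) Xs).
have rowE X : X \in Xs -> row (restr k X) = X.
  move=> XXs; have hX : has (fun X' => restr k X' == restr k X) Xs.
    by apply/hasP; exists X.
  by apply: inj => //; [rewrite mem_nth// -has_find|exact/eqP/(nth_find _ hX)].
exists (existT _ k [ffun u => [set v in map (restr k) (Ys (row u))]]) => /=.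
split=> [|X XXs]; first exact: leq_maxr.
have [sn ->] := cP X => Y YYs; rewrite /linked /= ffunE rowE//; split.
  by rewrite cardsE (leq_trans (card_size _))// size_map.
by rewrite inE map_f.
Qed.

(* The rows in [I] remain independent modulo the filter generated by [G]. *)
Definition independent (G : set (set node)) (I : set branch) : Prop :=
  forall (Gs : seq (set node)) (Xs : seq branch) (c : branch -> set node),
    [set` Gs] `<=` G -> [set` Xs] `<=` I -> (forall X, cell X (c X)) ->
    exists z, (forall B, B \in Gs -> B z) /\ (forall X, X \in Xs -> c X z).

Lemma independent_cofinite :
  independent [set B | finite_set (~` B)] setT.
Proof.
move=> Gs Xs c GsG _ cP.
have [m mP] : exists m, forall z : node, (m <= projT1 z)%N ->
    forall B, B \in Gs -> B z.
  elim: Gs GsG => [|B Gs IHG] GsG; first by exists 0%N.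
  have [|m mP] := IHG; first by move=> C CGs; apply: GsG => /=; rewrite inE CGs orbT.
  have [|n nP] := @finite_bounded_level (~` B); first by apply: GsG; exact: mem_head.
  exists (maxn m n) => z; rewrite geq_max => /andP[mz nz] C.
  rewrite inE => /orP[/eqP ->|]; last exact: mP.
  by apply: contrapT => /nP; rewrite ltnNge nz.
by have [z [mz zc]] := cells_meet Xs m cP; exists z; split=> //; exact: mP.
Qed.

Lemma independentS G I I' : I' `<=` I -> independent G I -> independent G I'.
Proof. by move=> I'I ind Gs Xs c GsG XsI; apply: ind => // X /XsI/I'I. Qed.

Lemma independent_cells G I (Xs : seq branch) (c : branch -> set node) :
  independent G I -> [set` Xs] `<=` I -> (forall X, cell X (c X)) ->
  independent (G `|` [set [set z | forall X, X \in Xs -> c X z]])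
              (I `\` [set` Xs]).
Proof.
move=> ind XsI cP Gs Ys d GsG YsI dP.
pose e X := if X \in Xs then c X else d X.
have [|||z [zG ze]] := ind [seq B <- Gs | `[< G B >]] (Xs ++ Ys) e.
- by move=> B /=; rewrite mem_filter => /andP[/asboolP].
- by move=> X /=; rewrite mem_cat => /orP[/XsI//|/YsI[]].
- by move=> X; rewrite /e; case: ifP.
exists z; split=> [B BGs|Y YYs].
  have [GB|->] := GsG _ BGs; first by apply: zG; rewrite mem_filter BGs andbT; exact/asboolP.
  by move=> X XXs; have := ze X; rewrite /e XXs mem_cat XXs; exact.
have := ze Y; rewrite /e mem_cat YYs orbT.
by have [_ /negP/negbTE ->] := YsI _ YYs; exact.
Qed.

(** Kunen's OK points. The decreasing neighbourhoods are the complements of the sets [psi z <= n],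
    and inclusions hold up to finite sets; the first alternative covers the case when some
    complement is not in [r]. *)
Definition ok_point (r : set_system node) (psi : node -> nat) : Prop :=
  (exists n, r [set z | (psi z <= n)%N]) \/
  exists C : branch -> set node, (forall b, r (C b)) /\
    forall n (bs : seq branch), uniq bs -> size bs = n.+1 ->
      finite_set [set z | (psi z <= n)%N /\ forall b, b \in bs -> C b z].

Lemma ultra_meet (T : Type) (F : set_system T) (A B : set T) :
  UltraFilter F -> F A -> F B -> exists x, A x /\ B x.
Proof. by move=> FU FA FB; apply: filter_ex (filterI FA FB). Qed.

Lemma ultra_setC (T : Type) (F : set_system T) (A : set T) :
  UltraFilter F -> ~ F A -> F (~` A).
Proof. by move=> FU nFA; have [] := in_ultra_setVsetC A FU. Qed.

Lemma filter_seq (T : choiceType) (F : set_system T) (Bs : seq (set T)) :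
  Filter F -> [set` Bs] `<=` F -> F [set z | forall B, B \in Bs -> B z].
Proof.
move=> FF; elim: Bs => [|B Bs IHB] BsF.
  by apply: filterS filterT => z _ B.
have FB : F B by apply: BsF; exact: mem_head.
have {}IHB : F [set z | forall C, C \in Bs -> C z].
  by apply: IHB => C /= CBs; apply: BsF; rewrite /= inE CBs orbT.
by apply: filterS2 FB IHB => z Bz zBs C; rewrite inE => /orP[/eqP ->//|/zBs].
Qed.

(* Either some intersection of cells already forces [psi] to be bounded, or the
   row [X0] can be diagonalised along the level sets of [psi]. *)
Lemma independent_ok G I X0 (psi : node -> nat) : independent G I -> I X0 ->
  exists (D : set (set node)) (Xs : seq branch),
    independent (G `|` D) (I `\` [set` Xs]) /\
    forall r, UltraFilter r -> G `|` D `<=` r -> ok_point r psi.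
Proof.
move=> ind IX0.
have [[n [Gs [Xs [c [GsG XsI cP zn]]]]]|nex] := pselect (exists (n : nat)
    (Gs : seq (set node)) (Xs : seq branch) (c : branch -> set node),
  [/\ [set` Gs] `<=` G, [set` Xs] `<=` I, forall X, cell X (c X) &
   forall z, (forall B, B \in Gs -> B z) -> (forall X, X \in Xs -> c X z) ->
     (psi z <= n)%N]).
  exists [set [set z | forall X, X \in Xs -> c X z]], Xs; split.
    exact: independent_cells.
  move=> r ru Gr; left; exists n.
  have /filter_seq rGs : [set` Gs] `<=` r by move=> B /GsG GB; apply: Gr; left.
  have rXs : r [set z | forall X, X \in Xs -> c X z] by apply: Gr; right.
  by apply: filterS2 rGs rXs => z; exact: zn.
(* The stage varies with [psi]: where [psi z <= n], the set [C b] lies in stage [n], in which [n.+1]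
   columns have a finite intersection. *)
pose C b := [set z : node | linked X0 b (psi z) z].
exists (range C), [:: X0]; split; last first.
  move=> r ru Gr; right; exists C; split=> [b|n bs ubs sbs].
    by apply: Gr; right; exists b.
  apply: sub_finite_set (linked_finite X0 ubs sbs) => z [zn zC] b bbs.
  exact: linkedS (zC _ bbs).
move=> Gs Xs c GsG XsI cP.
have /choice[b bP] : forall B : set node, exists b : branch,
    B \in Gs -> ~ G B -> B = C b.
  move=> B.
  have [[BGs nGB]|h] := pselect (B \in Gs /\ ~ G B).
    by have [//|[b _ <-]] := GsG _ BGs; exists b.
  by exists X0 => BGs nGB; case: h.
(* Where [psi z > size Gs], the cell [K] lies in every [C b] among [Gs]. If the given sets had no
   common node, the cells would force [psi z <= size Gs], contrary to [nex]. *)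
pose K := [set z | forall Y, Y \in map b Gs -> linked X0 Y (size Gs) z].
pose e X := if X == X0 then K else c X.
apply: contrapT => nz; apply: nex.
exists (size Gs), [seq B <- Gs | `[< G B >]], (X0 :: Xs), e; split.
- by move=> B /=; rewrite mem_filter => /andP[/asboolP].
- by move=> X /=; rewrite inE => /orP[/eqP ->//|/XsI[]].
- move=> X; rewrite /e; case: eqP => // ->.
  by exists (size Gs), (map b Gs); rewrite size_map.
move=> z zG ze; rewrite leqNgt; apply/negP => ltz; apply: nz; exists z; split.
  move=> B BGs; have [GB|nGB] := pselect (G B).
    by apply: zG; rewrite mem_filter BGs andbT; exact/asboolP.
  rewrite (bP B)//; apply: (linkedS (ltnW ltz)).
  by have := ze X0 (mem_head _ _); rewrite /e eqxx; apply; exact: map_f.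
move=> X XXs; have := ze X; rewrite /e inE XXs orbT => /(_ isT).
by case: eqP => // eX; have [_ []] := XsI _ XXs; rewrite /= inE eX.
Qed.

(** Two columns of stage [1] are almost disjoint. The first is added if its preimage is not in [q];
    otherwise the second, whose part outside the first has a preimage not in [q]. So [r] is not the
    image of [q] under [phi]. *)
Lemma independent_avoid G I X0 (q : set_system nat) (phi : nat -> node) :
  UltraFilter q -> independent G I -> I X0 -> [set B | finite_set (~` B)] `<=` G ->
  exists (D : set (set node)) (Xs : seq branch),
    independent (G `|` D) (I `\` [set` Xs]) /\
    forall r, UltraFilter r -> G `|` D `<=` r -> exists B, r B /\ ~ q (phi @^-1` B).
Proof.
move=> qu ind IX0 coG.
pose Y0 : branch := fun=> false; pose Y1 : branch := fun=> true.
have [Y YP] : exists Y, (Y = Y0 /\ ~ q (phi @^-1` linked X0 Y0 1)) \/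
    (Y = Y1 /\ q (phi @^-1` linked X0 Y0 1)).
  have [qY|nqY] := pselect (q (phi @^-1` linked X0 Y0 1)).
    by exists Y1; right.
  by exists Y0; left.
exists [set linked X0 Y 1], [:: X0]; split.
  have := @independent_cells G I [:: X0] (fun X => linked X Y 1) ind.
  have -> : [set z | forall X, X \in [:: X0] -> linked X Y 1 z] = linked X0 Y 1.
    apply/seteqP; split=> z; first by apply; rewrite mem_head.
    by move=> zX X; rewrite inE => /eqP ->.
  apply=> [X /=|X]; first by rewrite inE => /eqP ->.
  exact: cell_linked.
move=> r ru Gr; have rY : r (linked X0 Y 1) by apply: Gr; right.
case: YP => -[eY qY]; subst Y; first by exists (linked X0 Y0 1).
exists (linked X0 Y1 1 `\` linked X0 Y0 1); split.
  have uY : uniq [:: Y0; Y1].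
    by rewrite /= inE andbT; apply/eqP => /(congr1 (@^~ 0%N)).
  have co : r (~` [set z | forall Y, Y \in [:: Y0; Y1] -> linked X0 Y 1 z]).
    by apply: Gr; left; apply: coG => /=; rewrite setCK; exact: linked_finite.
  apply: filterS2 rY co => z z1 nz; split=> // z0; apply: nz => Y.
  by rewrite !inE => /orP[] /eqP ->.
move=> q1.
by have [n [n0 [_ /(_ n0)]]] := ultra_meet qu qY q1.
Qed.

Lemma filter_of_FIP (T : choiceType) (G : set (set T)) :
  (forall Gs : seq (set T), [set` Gs] `<=` G ->
     exists z, forall B, B \in Gs -> B z) ->
  exists r, UltraFilter r /\ G `<=` r.
Proof.
move=> fip.
pose F := filter_from [set Gs : seq (set T) | [set` Gs] `<=` G]
  (fun Gs => [set z | forall B, B \in Gs -> B z]).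
have FF : ProperFilter F.
  apply: filter_from_proper => [|Gs GsG]; last by have [z] := fip _ GsG; exists z.
  apply: filter_from_filter; first by exists [::].
  move=> Gs Hs GsG HsG; exists (Gs ++ Hs).
    by move=> B /=; rewrite mem_cat => /orP[/GsG|/HsG].
  by move=> z zGH; split=> B BG; apply: zGH; rewrite mem_cat BG ?orbT.
have [r [ru Fr]] := ultraFilterLemma FF.
exists r; split=> // B GB; apply: Fr; exists [:: B].
  by move=> C /=; rewrite inE => /eqP ->.
by move=> z; apply; rewrite mem_head.
Qed.

(* Transfinite recursion of length continuum: stage [t] handles one pair
   [(psi, phi)] and uses up finitely many rows, so that only a small set of rows
   is used before any stage. *)
Lemma ex_ok_ultrafilter (q : set_system nat) : UltraFilter q ->
  exists r : set_system node, [/\ UltraFilter r,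
    forall B, finite_set (~` B) -> r B,
    forall phi : nat -> node, exists B, r B /\ ~ q (phi @^-1` B) &
    forall psi : node -> nat, ok_point r psi].
Proof.
move=> qu.
have [lt [lt_wf lt_tr lt_tot nW]] := ex_small_well_order.
set W := [set x | _] in nW.
have [h hW] := not_small_surj nW.
pose z0 : node := existT _ 0%N [ffun=> finset.set0].
(* Stage [t] decodes [h t] into a pair [(psi, phi)]; as [h] maps [W] onto all branches, each pair is
   treated at some stage in [W]. *)
pose psi_of t (z : node) := seq_of_branch (row_of (h t) 0) (pickle z).
pose phi_of t n : node :=
  odflt z0 (unpickle (seq_of_branch (row_of (h t) 1) n)).
have surj (psi : node -> nat) (phi : nat -> node) :
    exists t, [/\ W t, psi_of t = psi & phi_of t = phi].
  have [x xE] := seq_of_branch_surj (fun n => if unpickle n is Some z then psi z else 0%N).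
  have [y yE] := seq_of_branch_surj (fun n => pickle (phi n)).
  have [u uE] := row_of_surj (fun n => if n is 0%N then x else y).
  have [t Wt tu] := hW u; exists t; split=> //; apply/funext => z.
    by rewrite /psi_of tu uE xE pickleK.
  by rewrite /phi_of tu uE yE pickleK.
pose G0 := [set B : set node | finite_set (~` B)].
pose ok t r := ok_point r (psi_of t) /\ exists B, r B /\ ~ q (phi_of t @^-1` B).
pose D : Type := (set (set node) * seq branch)%type.
pose spec t (G : set (set node)) (U : set branch) (d : D) :=
  independent (G `|` d.1) (~` U `\` [set` d.2]) /\
  forall r, UltraFilter r -> G `|` d.1 `<=` r -> ok t r.
have spec_ex t G U : G0 `<=` G -> small U -> independent G (~` U) ->
    exists d, spec t G U d.
  move=> G0G sU ind; have [X0 nX0] := small_ex sU.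
  have [D1 [Xs [ind1 ok1]]] := independent_ok (psi_of t) ind nX0.
  have [X1 nX1] := small_ex (smallU sU (small_seq Xs)).
  have [||D2 [Ys [ind2 av2]]] := @independent_avoid _ _ X1 q (phi_of t) qu ind1.
  - by split=> ?; apply: nX1; [left|right].
  - by move=> B /G0G GB; left.
  exists (D1 `|` D2, Xs ++ Ys); split=> [/=|r ru /= Gr]; last first.
    split; first by apply: ok1 => // B [GB|DB]; apply: Gr; [left|right; left].
    by apply: av2 => // B [[GB|DB]|DB]; apply: Gr; [left|right; left|right; right].
  rewrite setUA; apply: independentS ind2 => X [UX]; rewrite /= mem_cat => /negP.
  by rewrite negb_or => /andP[/negP ? /negP ?].
pose F t (rec : forall s, lt s t -> D) : D := xget (set0, [::])
  (spec t (G0 `|` [set B | exists s (st : lt s t), (rec s st).1 B])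
    [set X | exists s (st : lt s t), X \in (rec s st).2]).
pose d : branch -> D := Fix lt_wf (fun=> D) F.
pose GV (V : set branch) := G0 `|` [set B | exists2 s, V s & (d s).1 B].
pose G t := GV [set s | lt s t].
pose U t := \bigcup_(s in [set s | lt s t]) [set` (d s).2].
have dE t : d t = xget (set0, [::]) (spec t (G t) (U t)).
  rewrite /d Fix_eq; last first.
    move=> x f g fg; congr (F x _); apply/functional_extensionality_dep => y.
    by apply/functional_extensionality_dep => p; exact: fg.
  rewrite /F; congr (xget _ (spec t _ _)).
    by congr setU; apply/seteqP; split=> [B [s [st Bs]]|B [s st Bs]];
      [exists s|exists s, st].
  by apply/seteqP; split=> [X [s [st Xs]]|X [s st Xs]]; [exists s|exists s, st].
(* The stages form an increasing chain, so finitely many sets of [GV V] occur together at one stage,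
   unless all are cofinite. *)
have GVP V (Gs : seq (set node)) : [set` Gs] `<=` GV V ->
    [set` Gs] `<=` G0 \/ exists2 s, V s & [set` Gs] `<=` G s `|` (d s).1.
  elim: Gs => [|B Gs IHG] GsV; first by left.
  have G0S s : G0 `<=` G s by move=> ? ?; left.
  have mono s s' : lt s s' -> G s `|` (d s).1 `<=` G s' `|` (d s').1.
    move=> ss' C [[GC|[u us Cu]]|Cs]; left; [by left|right|by right; exists s].
    by exists u => //; exact: lt_tr ss'.
  have [|GsG0|[s Vs Gss]] := IHG.
  - by move=> C /= CGs; apply: GsV; rewrite /= inE CGs orbT.
  - have [GB|[s Vs Bs]] := GsV _ (mem_head _ _).
      by left=> C /=; rewrite inE => /orP[/eqP -> //|/GsG0].
    right; exists s => // C /=; rewrite inE => /orP[/eqP ->|/GsG0]; first by right.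
    by move=> ?; left; left.
  - right; have [GB|[s' Vs' Bs']] := GsV _ (mem_head _ _).
      exists s => // C /=; rewrite inE => /orP[/eqP -> //|/Gss//].
      by left; left.
    have [ss'|ss'|s's] := lt_tot s s'.
    + exists s' => // C /=; rewrite inE => /orP[/eqP ->|/Gss]; first by right.
      exact: mono.
    + subst s'; exists s => // C /=; rewrite inE => /orP[/eqP ->|/Gss//].
      by right.
    + exists s => // C /=; rewrite inE => /orP[/eqP ->|/Gss//].
      by apply: mono s's _ _; right.
have specP t : W t -> spec t (G t) (U t) (d t).
  elim/(well_founded_ind lt_wf): t => t IHt Wt.
  have WS s : lt s t -> W s.
    by move=> st; apply: small_sub Wt => u us; exact: lt_tr st.
  rewrite dE; apply: (@xgetPex _ _ (spec t (G t) (U t))).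
  apply: spec_ex => [B GB||]; [by left|exact: small_bigcup_seq|].
  move=> Gs Xs c GsG XsU cP; have [GsG0|[s st Gss]] := GVP _ _ GsG.
    exact: independent_cofinite.
  have [ind _] := IHt s st (WS s st).
  apply: (ind Gs Xs c Gss) => // X /XsU nX; split=> [Us|Xs']; last by apply: nX; exists s.
  by case: Us => u us Xu; apply: nX; exists u => //; exact: lt_tr st.
have [|r [ru Gr]] := @filter_of_FIP _ (GV W).
  move=> Gs /GVP[GsG0|[s Ws Gss]].
    have [|z [zG _]] := independent_cofinite GsG0 (Xs := [::]) _ (fun X => cell_linked X X).
      by move=> ? //.
    by exists z.
  have [ind _] := specP s Ws.
  have [|z [zG _]] := ind Gs [::] _ Gss _ (fun X => cell_linked X X); first by move=> ?.
  by exists z.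
have okW t : W t -> ok t r.
  move=> Wt; have [_] := specP t Wt; apply=> // B [[GB|[s st Bs]]|Bt]; apply: Gr.
  - by left.
  - by right; exists s => //; apply: small_sub Wt => u us; exact: lt_tr st.
  - by right; exists t.
exists r; split=> //.
- by move=> B fB; apply: Gr; left.
- by move=> phi; have [t [/okW[_] + _ <-]] := surj (fun=> 0%N) phi.
- by move=> psi; have [t [/okW[+ _] <- _]] := surj psi (fun=> z0).
Qed.

(* A linked family meets each of countably many ultrafilters only finitely often,
   so it has a member outside all of them. *)
Lemma ok_point_weak_P (r : set_system node) (A : set nat)
    (u : nat -> set_system node) :
  UltraFilter r -> (forall B, finite_set (~` B) -> r B) ->
  (forall psi, ok_point r psi) ->
  (forall n, A n -> [/\ UltraFilter (u n), u n <> r &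
                       forall B, finite_set (~` B) -> u n B]) ->
  exists B, r B /\ forall n, A n -> ~ u n B.
Proof.
move=> ru rfin rok uP.
have /choice[B BP] : forall n, exists B, r B /\ (A n -> u n (~` B)).
  move=> n; have [An|nAn] := pselect (A n); last by exists setT; split=> //; exact: filterT.
  have [un unr _] := uP n An; apply: contrapT => /forallNP nB; apply: unr.
  apply/esym/max_filter => B uB; apply: contrapT => /(ultra_setC ru) rB.
  by apply: (nB (~` B)); split=> // _; rewrite setCK.
(* Up to a finite set [V n] is the complement of [B n]; the second clause puts each node into some
   [V n], so that [psi] is defined. *)
pose V n := [set z : node | ~ B n z \/ (pickle z <= n)%N].
have psi_ex (z : node) : exists n, `[< V n z >].
  by exists (pickle z); apply/asboolP; right.
pose psi z := ex_minn (psi_ex z).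
have psi_le n z : V n z -> (psi z <= n)%N.
  by move=> Vnz; rewrite /psi; case: ex_minnP => m _; apply; exact/asboolP.
have psiV z : V (psi z) z by rewrite /psi; case: ex_minnP => m /asboolP.
have nrV n : ~ r (V n).
  move=> rV; have fin : r (~` [set z | (pickle z <= n)%N]).
    apply: rfin; rewrite setCK; apply: (@sub_finite_set _ _ (pickle @^-1` `I_n.+1)).
      by move=> z; rewrite /= ltnS.
    by apply: finite_preimage (finite_II _) => x y _ _; exact: (pcan_inj pickleK).
  have rBn : r (B n `&` ~` [set z | (pickle z <= n)%N]).
    by apply: filterI fin; exact: (BP n).1.
  by have [z [[nBz|zn] [Bz nzn]]] := ultra_meet ru rV rBn.
have nr n : ~ r [set z | (psi z <= n)%N].
  elim: n => [|n IHn] rn.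
    apply: (nrV 0%N); apply: filterS rn => z /=; rewrite leqn0 => /eqP z0.
    by rewrite -z0.
  have [/IHn//|rn'] := in_ultra_setVsetC [set z | (psi z <= n)%N] ru.
  apply: (nrV n.+1); apply: filterS2 rn rn' => z /= zn /negP.
  by rewrite -ltnNge => nz; rewrite (_ : n.+1 = psi z)//; apply/eqP; rewrite eqn_leq nz.
have [[n /nr//]|[C [rC fC]]] := rok psi.
(* [u n] contains the complement of [B n], where [psi z <= n]. If it also contained [C b] for [n.+1]
   different [b], it would contain a finite set, although it contains all cofinite ones. *)
have fin n : A n -> exists s : seq branch, forall b, u n (C b) -> b \in s.
  move=> An; have [un unr ufin] := uP n An; apply: contrapT => /forallNP ns.
  have sP m : exists s : seq branch, [/\ uniq s, size s = m &
      forall b, b \in s -> u n (C b)].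
    elim: m => [|m [s [us sm su]]]; first by exists [::].
    have /existsNP[b /not_implyP[ub /negP bs]] := ns s.
    exists (b :: s); split=> /= [| |b']; rewrite ?bs ?sm//.
    by rewrite inE => /orP[/eqP ->//|/su].
  have [s [us sn su]] := sP n.+1.
  have uC : u n [set z | forall D, D \in map C s -> D z].
    by apply: filter_seq => _ /= /mapP[b bs ->]; exact: su.
  have uV : u n [set z | (psi z <= n)%N].
    by apply: filterS ((BP n).2 An) => z nB; apply: psi_le; left.
  have uf := ufin (~` _) (eq_ind_r finite_set (fC n s us sn) (setCK _)).
  have uVC : u n ([set z | (psi z <= n)%N] `&`
      [set z | forall D, D \in map C s -> D z]) by exact: filterI.
  have [z [[zn zC]]] := ultra_meet un uVC uf.
  by apply; split=> // b bs; apply: zC; exact: map_f.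
have /choice[s sP] : forall n, exists s : seq branch, A n ->
    forall b, u n (C b) -> b \in s.
  move=> n; have [An|nAn] := pselect (A n); last by exists [::].
  by have [s sP] := fin n An; exists s.
have [b bP] : exists b, ~ (\bigcup_n [set` s n]) b.
  by apply: small_ex; apply: small_bigcup => n; exact: small_seq.
by exists (C b); split=> // n An ub; apply: bP; exists n => //; exact: sP ub.
Qed.

(** * Copies of beta omega in countable products *)

(* When the range has compact closure, this says that the closure is the
   Stone-Cech compactification of the (discrete) range. *)
Definition beta_seq (J : Type) (Y : topologicalType) (z : J -> Y) : Prop :=
  forall B : set J, closure (z @` B) `&` closure (z @` (~` B)) = set0.

Lemma closed_ultra_cvg (Y : topologicalType) (r : set_system Y) (p : Y) (E : set Y) :
  UltraFilter r -> r --> p -> closed E -> r E -> E p.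
Proof.
move=> ru rp cE rE; apply: cE => B pB; have [z [Ez Bz]] := ultra_meet ru rE (rp _ pB).
by exists z.
Qed.

Lemma compact_fip (Y : topologicalType) (Q : set Y) (E : set (set Y)) :
  compact Q -> (forall B, E B -> closed B) ->
  (forall Bs : seq (set Y), [set` Bs] `<=` E ->
    exists z, Q z /\ forall B, B \in Bs -> B z) ->
  exists z, Q z /\ forall B, E B -> B z.
Proof.
move=> cQ cE fip; have [|r [ru Er]] := @filter_of_FIP _ (E `|` [set Q]).
  move=> Gs GsE; have [|z [Qz zG]] := fip [seq B <- Gs | `[< E B >]].
    by move=> B /=; rewrite mem_filter => /andP[/asboolP].
  exists z => B BGs; have [EB|->//] := GsE _ BGs.
  by apply: zG; rewrite mem_filter BGs andbT; exact/asboolP.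
move: cQ; rewrite compact_ultra => /(_ r ru (Er _ (or_intror erefl)))[p [Qp rp]].
exists p; split=> // B EB; apply: closed_ultra_cvg rp (cE _ EB) _.
by apply: Er; left.
Qed.

Lemma pickle_pair_inj (n m n' m' : nat) :
  pickle (n, m) = pickle (n', m') -> n = n' /\ m = m'.
Proof. by move=> /(pcan_inj pickleK)[-> ->]. Qed.

Lemma closureUS (Y : topologicalType) (A B : set Y) (z : Y) :
  closure A z -> A `<=` closure B -> closure B z.
Proof.
move=> zA AB; have := closureS AB zA.
by rewrite -(closure_id (closure B)).1//; exact: closed_closure.
Qed.

(* Iterating the failure of [beta_seq] multiplies the number of disjoint sets of
   indices along which [w] accumulates at a common point. *)
Lemma ex_multiple_limit (Y : topologicalType) (Q : set Y) (k : nat) (w : nat -> Y) :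
  closed Q -> (forall z : nat -> Y, (forall n, Q (z n)) -> ~ beta_seq z) ->
  (forall n, Q (w n)) ->
  exists (z : Y) (A : nat -> set nat), [/\ Q z,
    forall i j x, (i <= k)%N -> (j <= k)%N -> A i x -> A j x -> i = j &
    forall j, (j <= k)%N -> closure (w @` A j) z].
Proof.
move=> cQ nb; elim: k w => [|k IHk] w wQ.
  exists (w 0%N), (fun=> setT); split=> // [i j x|j _].
    by rewrite !leqn0 => /eqP -> /eqP ->.
  by apply: subset_closure; exists 0%N.
have {}IHk (n : nat) := IHk (fun m => w (pickle (n, m))) (fun m => wQ _).
have [z zP] := choice IHk.
have [A zA] := choice zP.
have zQ n : Q (z n) by have [] := zA n.
have /existsNP[B /eqP/set0P[p [pB pnB]]] := nb z zQ.
pose img (N : set nat) j := [set x | exists n m, [/\ N n, A n j m & x = pickle (n, m)]].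
have imgP N j p' : (j <= k)%N -> closure (z @` N) p' -> closure (w @` img N j) p'.
  move=> jk /closureUS; apply=> _ [n Nn <-]; have [_ _ /(_ j jk)] := zA n.
  by apply: closureS => _ [m Am <-]; exists (pickle (n, m)) => //; exists n, m.
(* The blocks in [B] give the sets with indices up to [k]; one set inside the remaining blocks gets
   the new index [k.+1]. *)
exists p, (fun j => if (j <= k)%N then img B j else img (~` B) 0%N); split.
- have -> : Q = closure Q by exact/closure_id.
  by apply: closureS pB => _ [n _ <-].
- have disj (n n' m m' : nat) : pickle (n, m) = pickle (n', m') -> B n -> ~ B n' -> False.
    by move=> /pickle_pair_inj[-> _].
  move=> i j x ik1 jk1; have [ik|ki] := leqP i k; have [jk|kj] := leqP j k.
  + move=> [n [m [Bn Am ->]]] [n' [m' [_ Am' /pickle_pair_inj[]]]] en em.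
    by subst n' m'; have [_ /(_ i j m ik jk Am Am')] := zA n.
  + by move=> [n [m [Bn _ ->]]] [n' [m' [nB _ /disj]]] => /(_ Bn nB).
  + by move=> [n [m [nB _ ->]]] [n' [m' [Bn _ /esym/disj]]] => /(_ Bn nB).
  + by move=> _ _; apply/eqP; rewrite eqn_leq (leq_trans ik1 kj) (leq_trans jk1 ki).
- move=> j _; case: leqP => jk; first exact: imgP.
  exact: imgP.
Qed.

(** The limit is a cluster point of the limits of longer and longer finite families on disjoint
    blocks; the [j]-th set collects the [j]-th members from block [j] on. *)
Lemma ex_infinite_limit (Y : topologicalType) (Q : set Y) (w : nat -> Y) :
  compact Q -> closed Q ->
  (forall z : nat -> Y, (forall n, Q (z n)) -> ~ beta_seq z) ->
  (forall n, Q (w n)) ->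
  exists (z : Y) (A : nat -> set nat),
    [/\ Q z, forall i j x, A i x -> A j x -> i = j &
    forall j, closure (w @` A j) z].
Proof.
move=> coQ cQ nb wQ.
have lim (n : nat) :=
  @ex_multiple_limit Y Q n (fun m => w (pickle (n, m))) cQ nb (fun m => wQ _).
have [z zP] := choice lim.
have [A zA] := choice zP.
have [|p [Qp pz]] := coQ (z @ \oo).
  by exists 0%N => // n _ /=; have [] := zA n.
exists p, (fun j => [set x | exists n m, [/\ (j <= n)%N, A n j m & x = pickle (n, m)]]).
split=> //.
  move=> i j _ [n [m [ni Am ->]]] [n' [m' [nj Am' /pickle_pair_inj[]]]] en em.
  by subst n' m'; have [_ /(_ i j m ni nj Am Am')] := zA n.
move=> j; have pj : closure (z @` [set n | (j <= n)%N]) p.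
  by move: pz; rewrite clusterE; apply; exists j => // n /= jn; exists n.
apply: closureUS pj _ => _ [n /= jn <-]; have [_ _ /(_ j jn)] := zA n.
by apply: closureS => _ [m Am <-]; exists (pickle (n, m)) => //; exists n, m.
Qed.

(* For disjoint pairs [P t true], [P t false] this says that [L] maps onto the
   Cantor cube over the complement of [S]. *)
Definition full (K : Type) (P : branch -> bool -> set K) (S : set branch)
    (L : set K) : Prop :=
  forall eta : branch -> bool, exists z, L z /\ forall t, ~ S t -> P t (eta t) z.

Lemma closed_fiber (K Y : topologicalType) (f : K -> Y) (y : Y) :
  hausdorff_space Y -> continuous f -> closed (f @^-1` [set y]).
Proof.
move=> hY cf; apply: preimage_closed => //.
exact/accessible_closed_set1/hausdorff_accessible.
Qed.

(* If no fibre is full off a small set, compactness of [Y] yields continuum many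
   finite families of closed subsets of [f @` L], indexed by disjoint sets of
   coordinates, each with empty intersection although one can choose a member
   of each family at will and still obtain a nonempty intersection. Reading the
   choices off the functions from nat to nat gives a sequence in [f @` L] which
   does not accumulate at a point along infinitely many disjoint sets of
   indices, so [ex_infinite_limit] applies. *)
Lemma full_fiber (K Y : topologicalType) (P : branch -> bool -> set K)
    (f : K -> Y) (L : set K) (S : set branch) :
  compact [set: K] -> hausdorff_space Y -> continuous f ->
  (forall t b, closed (P t b)) -> closed L -> small S -> full P S L ->
  (forall z : nat -> Y, range z `<=` f @` L -> ~ beta_seq z) ->
  exists y S', [/\ S `<=` S', small S' & full P S' (L `&` f @^-1` [set y])].
Proof.
move=> coK hY cf cP cL sS fullL nb.
pose box (xs : seq branch) (v : branch -> bool) :=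
  L `&` [set z | forall t, t \in xs -> P t (v t) z].
have c_box xs v : closed (f @` box xs v).
  apply: compact_closed => //; apply: continuous_compact.
    exact: continuous_subspaceT.
  apply: subclosed_compact coK _ => //; apply: closedI => //.
  have -> : [set z | forall t, t \in xs -> P t (v t) z] =
      \bigcap_(t in [set` xs]) P t (v t) by [].
  by apply: closed_bigI => t _; exact: cP.
have cofL : compact (f @` L).
  by apply: continuous_compact; [exact: continuous_subspaceT|exact: subclosed_compact coK _].
have cfL : closed (f @` L) by exact: compact_closed.
apply: contrapT => nfib.
pose good (tau : seq branch * seq (branch -> bool)) :=
  (forall t, t \in tau.1 -> ~ S t) /\
  ~ exists y, (f @` L) y /\ forall v, v \in tau.2 -> (f @` box tau.1 v) y.
pose disj (F : set (seq branch * seq (branch -> bool))) :=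
  F `<=` good /\ forall tau tau' t, F tau -> F tau' ->
    t \in tau.1 -> t \in tau'.1 -> tau = tau'.
have good_nil tau : good tau -> tau.1 <> [::].
  move=> [_ ng] tau0; apply: ng; have [z [Lz _]] := fullL (fun=> true).
  exists (f z); split=> [|v _]; first by exists z.
  by exists z => //; split=> // t; rewrite tau0.
have [F [[Fgood Fdisj] Fmax]] : exists F, disj F /\ forall G, F `<` G -> ~ disj G.
  apply: Zorn_bigcup => C CP Ctot; split=> [tau [F CF]|tau tau' t [F CF Ft] [G CG Gt]].
    by have [Fg _] := CP _ CF; exact: Fg.
  have [FG|GF] := Ctot _ _ CF CG.
    by have [_] := CP _ CG; apply=> //; exact: FG.
  by have [_] := CP _ CF; apply=> //; exact: GF.
pose U := \bigcup_(tau in F) [set` tau.1].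
have [sU|nsU] := pselect (small U).
  pose S' := S `|` U.
  have sS' : small S' by exact: smallU.
  have /choice[eta etaP] : forall y, exists eta : branch -> bool,
      ~ exists z, (L `&` f @^-1` [set y]) z /\ forall t, ~ S' t -> P t (eta t) z.
    move=> y; apply/existsNP => fy; apply: nfib; exists y, S'; split=> //.
    by move=> s Ss; left.
  have /choice[xs xsP] : forall y, exists xs : seq branch,
      (forall t, t \in xs -> ~ S' t) /\ ~ (f @` box xs (eta y)) y.
    move=> y; apply: contrapT => nxs; apply: (etaP y).
    have [||Bs BsP|z [Lz zP]] := @compact_fip K (L `&` f @^-1` [set y])
        [set B | exists2 t, ~ S' t & B = P t (eta y t)].
    - apply: subclosed_compact coK _ => //; apply: closedI => //.
      exact: closed_fiber.
    - by move=> _ [t _ ->].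
    - have /choice[tt ttP] : forall B : set K, exists t : branch,
          B \in Bs -> ~ S' t /\ B = P t (eta y t).
        move=> B; have [/BsP[t nt ->]|nB] := boolP (B \in Bs); first by exists t.
        by exists (fun=> true).
      apply: contrapT => nz; apply: nxs; exists (map tt Bs); split.
        by move=> _ /mapP[B /ttP[nB _] ->].
      move=> [z [Lz zt] fz]; apply: nz; exists z; split=> // B BBs.
      by have [_ ->] := ttP B BBs; apply: zt; exact: map_f.
    - by exists z; split=> // t nt; apply: zP; exists t.
  have [ys ysP] : exists ys : seq Y, ~ exists y, (f @` L) y /\
      forall y', y' \in ys -> (f @` box (xs y') (eta y')) y.
    apply: contrapT => /forallNP nys.
    have [|Bs BsP|y [_ yP]] := @compact_fip Y (f @` L)
        [set B | exists y, B = f @` box (xs y) (eta y)] cofL.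
    - by move=> _ [y ->].
    - have /choice[yy yyP] : forall B : set Y, exists y : Y,
          B \in Bs -> B = f @` box (xs y) (eta y).
        move=> B; have [/BsP[y ->]|nB] := boolP (B \in Bs); first by exists y.
        by have [z _] := fullL (fun=> true); exists (f z).
      have [y [fLy yP]] := contrapT (nys (map yy Bs)).
      exists y; split=> // B BBs; rewrite (yyP B BBs); apply: yP; exact: map_f.
    - by have [_ []] := xsP y; apply: yP; exists y.
  pose tau := (flatten (map xs ys), map eta ys).
  have tauU t : t \in tau.1 -> ~ S' t.
    by move=> /flatten_mapP[y _] txs; have [+ _] := xsP y; exact.
  have gtau : good tau.
    split=> [t /tauU nS' St|[y [fLy yP]]]; first by apply: nS'; left.
    apply: ysP; exists y; split=> // y' y'ys.
    have [z [Lz zP] <-] := yP _ (map_f eta y'ys).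
    exists z => //; split=> // t txs; apply: zP; apply/flatten_mapP.
    by exists y'.
  have [t t_tau] : exists t, t \in tau.1.
    by have := good_nil _ gtau; case: tau.1 => // t s _; exists t; rewrite mem_head.
  apply: (Fmax (F `|` [set tau])).
    split=> [?|/(_ tau (or_intror erefl)) Ftau]; first by left.
    by apply: (tauU _ t_tau); right; exists tau.
  split=> [_ [/Fgood//|->//]|].
  move=> tau1 tau2 u [F1|->] [F2|->] //; first exact: Fdisj.
  - by move=> u1 /tauU[]; right; exists tau1.
  - by move=> ut u2; case: (tauU _ ut); right; exists tau2.
(* By Koenig's argument the coordinates at one position [n] already form a set that is not small, so
   members of [F] can be indexed by all branches. *)
have [n nV] : exists n, ~ small [set t | exists2 tau, F tau &
    (n < size tau.1)%N /\ t = nth (fun=> true) tau.1 n].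
  apply: contrapT => /forallNP sV; apply: nsU.
  apply: small_sub (small_bigcup (fun n => contrapT (sV n))) => t [tau Ftau /= tt].
  exists (index t tau.1) => //; exists tau => //.
  by rewrite index_mem nth_index.
set V := [set t | _] in nV.
have [h hV] := not_small_surj nV.
have /choice[tau tauP] : forall x, exists tau, [/\ F tau, (n < size tau.1)%N &
    h (nth (fun=> true) tau.1 n) = x].
  by move=> x; have [_ [tau Ftau [nt ->]] hx] := hV x; exists tau.
have Ftau x : F (tau x) by have [] := tauP x.
have tau_inj x y : tau x = tau y -> x = y.
  by move=> e; have [_ _ <-] := tauP x; have [_ _ <-] := tauP y; rewrite e.
have /choice[own ownP] : forall t, exists x, forall y, t \in (tau y).1 -> y = x.
  move=> t; have [[x tx]|nx] := pselect (exists x, t \in (tau x).1).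
    by exists x => y ty; apply: tau_inj; apply: Fdisj ty tx.
  by exists t => y ty; exfalso; apply: nx; exists y.
pose vs x i := nth (fun=> true) (tau x).2 (minn i (size (tau x).2).-1).
have /choice[z zP] : forall k, exists z, L z /\ forall t, ~ S t ->
    P t (vs (own t) (seq_of_branch (own t) k) t) z.
  by move=> k; exact: (fullL (fun t => vs (own t) (seq_of_branch (own t) k) t)).
have fzP k x : (f @` box (tau x).1 (vs x (seq_of_branch x k))) (f (z k)).
  have [Lz zt] := zP k; exists (z k) => //; split=> // t tx.
  have -> : x = own t by exact: ownP.
  by apply: zt; have [+ _] := Fgood _ (Ftau x); exact.
have [||p [A [fLp Adisj pA]]] := @ex_infinite_limit Y (f @` L) (f \o z) cofL cfL.
- by move=> w wL; apply: nb => _ [k _ <-]; exact: wL.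
- by move=> k; exists (z k) => //; have [] := zP k.
have /choice[i iP] : forall k, exists j, forall j', A j' k -> j' = j.
  move=> k; have [[j Aj]|nj] := pselect (exists j, A j k).
    by exists j => j' Aj'; exact: Adisj Aj.
  by exists 0%N => j Aj; exfalso; apply: nj; exists j.
(* With [i] as the choices, the points with indices in [A j] lie in the image of the [j]-th box of
   [tau x]; these closed images share [p], although [tau x] is good. *)
have [x xi] := seq_of_branch_surj i.
have [_ []] := Fgood _ (Ftau x); exists p; split=> // v /(nthP (fun=> true))[j js <-].
have -> : f @` box (tau x).1 (nth xpredT (tau x).2 j) =
    closure (f @` box (tau x).1 (nth xpredT (tau x).2 j)) by exact/closure_id.
apply: closureS (pA j) => _ [k Ajk <-] /=; have := fzP k x.
rewrite xi -(iP _ _ Ajk) /vs (minn_idPl _)//.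
by rewrite -ltnS prednK// (leq_ltn_trans _ js).
Qed.

Definition half (t : branch) (b : bool) : set node :=
  if b then linked t (fun=> false) 1 else ~` linked t (fun=> false) 1.

(** A set of at most one restricted column cannot contain both constant ones, so belonging to the
    second forces [half t false]. Level at least [1] keeps their restrictions different. *)
Lemma half_meet (ts : seq branch) (eta : branch -> bool) :
  exists z : node, forall t, t \in ts -> half t (eta t) z.
Proof.
have [z [z1 zt]] := cells_meet ts 1 (fun t => cell_linked t (fun=> ~~ eta t)).
exists z => t /zt; rewrite /half; case: (eta t) => //= -[zle z2] [_ z3].
move: zle; rewrite leqNgt => /negP; apply.
set Z := projT2 z _ in z2 z3 *.
rewrite (cardsD1 (restr (projT1 z) xpredT)) z2 (cardsD1 (restr (projT1 z) xpred0)).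
rewrite !inE z3 andbT; case: eqP => // e.
have := congr1 (fun u => tnth u (Ordinal z1)) e.
by rewrite !tnth_mktuple.
Qed.

(* Malykhin's theorem that a countable product of spaces containing no copy of
   beta omega contains none; if [d] were a copy of omega in the product of the
   [Y k] with closure beta omega, the points [a] and [b] would be separated by
   some coordinate. *)
Lemma ex_coordinatewise_equal (K : topologicalType) (Y : nat -> topologicalType)
    (f : forall k, K -> Y k) (d : node -> K) :
  compact [set: K] -> (forall k, hausdorff_space (Y k)) ->
  (forall k, continuous (f k)) ->
  (forall k (z : nat -> Y k), range z `<=` f k @` closure (range d) -> ~ beta_seq z) ->
  exists (P : set node) a b,
    [/\ closure (d @` P) a, closure (d @` (~` P)) b & forall k, f k a = f k b].
Proof.
move=> coK hY cf nb.
pose P t b := closure (d @` half t b).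
have cP t b : closed (P t b) by exact: closed_closure.
pose good (LS : set K * set branch) :=
  [/\ closed LS.1, LS.1 `<=` closure (range d), small LS.2 & full P LS.2 LS.1].
have /choice[step stepP] : forall kLS : nat * (set K * set branch),
    exists LS', good kLS.2 -> [/\ good LS', LS'.1 `<=` kLS.2.1,
      kLS.2.2 `<=` LS'.2 & exists y, LS'.1 `<=` f kLS.1 @^-1` [set y]].
  move=> [k [L S]] /=; have [[/= cL dL sS fL]|ng] := pselect (good (L, S)); last first.
    by exists (L, S) => /ng.
  have [|y [S' [SS' sS' fS']]] := full_fiber coK (hY k) (cf k) cP cL sS fL.
    by move=> z zL; apply: nb => y /zL[u /dL Lu <-]; exists u.
  exists (L `&` f k @^-1` [set y], S') => _; split=> //=; last by exists y => z [].
  split=> //=; last by move=> z [/dL].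
  by apply: closedI => //; exact: closed_fiber.
pose LS := fix LS n := if n is k.+1 then step (k, LS k) else (closure (range d), set0).
have LSgood n : good (LS n).
  elim: n => [|n IHn] /=; last by have [] := stepP (n, LS n) IHn.
  split=> //=; [exact: closed_closure|exact: small0|].
  move=> eta; have [|B [t _ ->]//|Bs BsP|z [dz zP]] := @compact_fip K (closure (range d))
      [set B | exists2 t, True & B = P t (eta t)].
  - by apply: subclosed_compact coK _ => //; exact: closed_closure.
  - have /choice[tt ttP] : forall B : set K, exists t : branch,
        B \in Bs -> B = P t (eta t).
      move=> B; have [/BsP[t _ ->]|nB] := boolP (B \in Bs); first by exists t.
      by exists (fun=> true).
    have [z zP] := half_meet (map tt Bs) eta; exists (d z); split.
      by apply: subset_closure; exists z.
    move=> B BBs.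
    rewrite (ttP B BBs); apply: subset_closure; exists z => //; apply: zP.
    exact: map_f.
  - by exists z; split=> // t _; apply: zP; exists t.
(* Countably many steps use up only a small set of coordinates. At a remaining [t0], compactness
   gives points on either side in the intersection of the nested sets, where every [f k] is
   constant. *)
pose S := \bigcup_n (LS n).2.
have [t0 nt0] : exists t, ~ S t.
  by apply: small_ex; apply: small_bigcup => n; have [] := LSgood n.
pose tube b n := (LS n).1 `&` [set z | forall t, ~ S t -> P t b z].
have tubeS b m n : (m <= n)%N -> tube b n `<=` tube b m.
  move=> /subnKC <-; elim: (n - m)%N => [|k IHk]; first by rewrite addn0.
  rewrite addnS => z [Lz zP]; apply: IHk; split=> //.
  have [_ LL _ _] := stepP ((m + k)%N, LS (m + k)%N) (LSgood _).
  exact: LL Lz.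
have ex b : exists z, forall n, tube b n z.
  have [|_ [n _ <-]|Bs BsP|z [_ zP]] := @compact_fip K setT (range (tube b)).
  - by [].
  - apply: closedI; first by have [] := LSgood n.
    have -> : [set z | forall t, ~ S t -> P t b z] = \bigcap_(t in ~` S) P t b by [].
    by apply: closed_bigI.
  - have [n nP] : exists n, forall B, B \in Bs -> tube b n `<=` B.
      elim: Bs BsP => [|B Bs IHB] BsP; first by exists 0%N.
      have [|n nP] := IHB; first by move=> C /= CB; apply: BsP; rewrite /= inE CB orbT.
      have [m _ mB] := BsP _ (mem_head _ _).
      exists (maxn n m) => C; rewrite inE => /orP[/eqP ->|CB].
        by rewrite -mB; apply: tubeS; exact: leq_maxr.
      by apply: subset_trans (nP _ CB); apply: tubeS; exact: leq_maxl.
    have [_ _ _ /(_ (fun=> b))[z [Lz zP]]] := LSgood n.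
    exists z; split=> // B BBs; apply: (nP _ BBs); split=> // t nt.
    by apply: zP => nSt; apply: nt; exists n.
  - by exists z => n; apply: zP; exists n.
have [a aP] := ex true; have [b bP] := ex false.
exists (half t0 true), a, b; split=> [||k].
- by have [_] := aP 0%N; exact.
- by have [_ /(_ _ nt0)] := bP 0%N.
have [_ _ _ [y yP]] := stepP (k, LS k) (LSgood k).
have [La _] := aP k.+1; have [Lb _] := bP k.+1.
by rewrite (yP _ La) (yP _ Lb).
Qed.

(** * Limits in beta-omega-spaces *)

(* [Phi b] is the sum of [b k / 4 ^ k.+1]. *)
Lemma ex_cantor_embedding (R : realType) : exists Phi : branch -> R,
  injective Phi /\ forall b (e : R), (0 < e)%R -> exists n, forall b',
    (forall k, (k < n)%N -> b' k = b k) -> (`|Phi b' - Phi b| < e)%R.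
Proof.
Local Open Scope ring_scope.
pose w n : R := (4 ^+ n)^-1.
have w0 n : 0 < w n by rewrite invr_gt0 exprn_gt0.
have wS n : w n = 4 * w n.+1.
  by rewrite /w exprS invfM mulrA divff ?mul1r.
pose S (b : branch) n : R := \sum_(k < n) (b k)%:R * w k.+1.
have SS b n : S b n.+1 = S b n + (b n)%:R * w n.+1 by rewrite /S big_ord_recr.
have S_ge b m n : S b m <= S b (m + n)%N.
  elim: n => [|n IHn]; first by rewrite addn0.
  by rewrite addnS SS (le_trans IHn)// lerDl mulr_ge0// ltW.
have S_le b m n : S b (m + n)%N <= S b m + (w m - w (m + n)%N) / 3.
  elim: n => [|n IHn]; first by rewrite addn0 subrr mul0r addr0.
  have bw : (b (m + n)%N)%:R * w (m + n).+1 <= w (m + n).+1.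
    by rewrite ler_piMl ?lern1 ?leq_b1// ltW.
  by rewrite addnS SS; have := wS (m + n)%N; lra.
pose Phi b := sup (range (S b)).
have PhiP b n : S b n <= Phi b <= S b n + w n / 3.
  have ub m : S b m <= S b n + w n / 3.
    have [mn|/ltnW nm] := leqP m n.
      have := S_ge b m (n - m)%N; rewrite subnKC// => /le_trans; apply.
      by rewrite lerDl divr_ge0// ltW.
    have := S_le b n (m - n)%N; rewrite subnKC// => /le_trans; apply.
    by rewrite lerD2l ler_pM2r ?invr_gt0// lerBlDr lerDl ltW.
  apply/andP; split.
    apply: ub_le_sup; last by exists n.
    by exists (S b n + w n / 3) => _ [m _ <-].
  by apply: ge_sup => [|_ [m _ <-]//]; exists (S b 0%N); exists 0%N.
have SE b b' n : (forall k, (k < n)%N -> b' k = b k) -> S b' n = S b n.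
  by move=> bb'; apply: eq_bigr => k _; rewrite bb'.
have Phi_lt b b' n : (forall k, (k < n)%N -> b' k = b k) -> b n = false ->
    b' n = true -> Phi b < Phi b'.
  move=> bb' bn b'n; have /andP[_ h1] := PhiP b n.+1; have /andP[h2 _] := PhiP b' n.+1.
  move: h1 h2; rewrite !SS bn b'n (SE _ _ _ bb') mul0r mul1r addr0.
  by have := w0 n.+1; lra.
exists Phi; split=> [b b' PP|b e e0].
  apply: contrapT => nbb'; have [n nP] : exists n, b n != b' n.
    apply: contrapT => /forallNP h; apply: nbb'; apply/funext => n.
    exact/eqP/negPn/negP/h.
  have [m mP mmin] := ex_minnP (ex_intro (fun n => b n != b' n) n nP).
  have bb' k : (k < m)%N -> b' k = b k.
    by move=> km; apply/esym/eqP; apply: contraLR km; rewrite -leqNgt => /mmin.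
  case bm: (b m) mP; case b'm: (b' m) => // _.
    have := Phi_lt b' b m (fun k km => esym (bb' k km)) b'm bm.
    by rewrite PP ltxx.
  by have := Phi_lt b b' m bb' bm b'm; rewrite PP ltxx.
have [n ne] : exists n, w n < e.
  exists (Num.truncn e^-1).+1; rewrite /w invf_plt ?posrE ?exprn_gt0//.
  have := truncnS_gt e^-1; move=> /lt_le_trans; apply.
  by rewrite -natrX ler_nat ltnW// ltn_expl.
exists n => b' bb'; have /andP[h1 h2] := PhiP b n; have /andP[h3 h4] := PhiP b' n.
move: h3 h4; rewrite (SE _ _ _ bb') => h3 h4; have := w0 n.
by rewrite ltr_norml => *; apply/andP; split; lra.
Qed.

Lemma discrete_setP (X : topologicalType) (D : set X) :
  discrete_set D <-> forall x, D x ->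
    exists U, [/\ open U, U x & forall y, D y -> U y -> y = x].
Proof.
split=> [disc x Dx|loc U].
  have [V oV VE] := disc [set y : set_type D | set_val y = x].
  exists V; split=> // [|y Dy Vy].
    have : [set y : set_type D | set_val y = x] (exist _ x (mem_set Dx)) by [].
    by rewrite -VE.
  have : (set_val @^-1` V) (exist _ y (mem_set Dy) : set_type D) by [].
  by rewrite VE.
have /choice[V VP] : forall x, exists V, D x ->
    [/\ open V, V x & forall y, D y -> V y -> y = x].
  move=> x; have [Dx|nDx] := pselect (D x); last by exists setT.
  by have [V VP] := loc x Dx; exists V.
exists (\bigcup_(u in U) V (set_val u)).
  by apply: bigcup_open => u _; have [] := VP _ (set_valP u).
apply/seteqP; split=> [u [v Uv Vuv]|u Uu]; last first.
  by exists u => //; have [] := VP _ (set_valP u).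
have [_ _ /(_ _ (set_valP u) Vuv) uv] := VP _ (set_valP v).
by have -> : u = v by apply: val_inj.
Qed.

(** The characteristic function of [E] is continuous on the discrete set [D]; its extension to the
    closure would take both values at a common point. *)
Lemma beta_omega_closures (Y : topologicalType) (D E : set Y) :
  compact [set: Y] -> beta_omega_space Y -> countable D -> discrete_set D ->
  E `<=` D -> closure E `&` closure (D `\` E) = set0.
Proof.
move=> coY bY cD disc ED.
have coD : compact (closure D).
  by apply: subclosed_compact coY _ => //; exact: closed_closure.
have [_ _ _ _ ext] := bY D cD disc coD.
pose f (u : set_type D) : bool := `[< E (set_val u) >].
have cf : continuous f by apply/continuousP => B _; exact: disc.
have [g [cg gf]] := ext bool f bool_compact discrete_hausdorff cf.
rewrite -subset0 => z [z1 z2].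
have Dz : closure D z by exact: closureS z1.
pose zz : set_type (closure D) := exist _ z (mem_set Dz).
have side (b : bool) (F : set Y) : closure F z ->
    (forall y, F y -> exists u : set_type D, set_val u = y /\ f u = b) -> g zz = b.
  move=> Fz fF; have : nbhs zz (g @^-1` [set g zz]) by apply: cg; exact: discrete_set1.
  rewrite nbhsE => -[W [[V oV VW] Wzz] Wg].
  have Vz : V z by move: Wzz; rewrite -VW.
  have [y [Fy Vy]] := Fz V (open_nbhs_nbhs (conj oV Vz)).
  have [u [uy <-]] := fF y Fy; rewrite -gf; apply/esym/Wg; rewrite -VW.
  by rewrite -uy in Vy.
have : g zz = true.
  apply: side z1 _ => y Ey; exists (exist _ y (mem_set (ED _ Ey))).
  by split=> //; exact/asboolP.
rewrite (side false _ z2) // => y [Dy nEy]; exists (exist _ y (mem_set Dy)).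
by split=> //; exact/asboolP.
Qed.

Lemma hausdorff_separate (Y : topologicalType) (x y : Y) :
  hausdorff_space Y -> x <> y ->
  exists A B, [/\ open A, open B, A x, B y & A `&` B = set0].
Proof.
rewrite open_hausdorff => hY /eqP /hY[[A B] /= + [oA oB /eqP AB]].
by rewrite !inE => -[Ax By]; exists A, B.
Qed.

Lemma open_setD_finite (Y : topologicalType) (V F : set Y) :
  hausdorff_space Y -> open V -> finite_set F -> open (V `\` F).
Proof.
move=> hY oV fF; rewrite setDE; apply: openI => //; rewrite openC.
by apply: (accessible_finite_set_closed.1 _ _ fF); exact: hausdorff_accessible.
Qed.

(** An infinite open set splits into a nonempty open part and a disjoint infinite open part; a point
    with a finite neighbourhood is isolated and may itself be the first part. *)
Lemma ex_cellular (Y : topologicalType) :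
  hausdorff_space Y -> infinite_set [set: Y] ->
  exists O : nat -> set Y, [/\ forall n, open (O n), forall n, O n !=set0 &
    forall m n x, O m x -> O n x -> m = n].
Proof.
move=> hY infY.
have split_open (V : set Y) : open V -> infinite_set V ->
    exists OV : set Y * set Y, [/\ open OV.1, OV.1 !=set0, OV.1 `<=` V &
      [/\ open OV.2, infinite_set OV.2, OV.2 `<=` V & OV.1 `&` OV.2 = set0]].
  move=> oV infV.
  have [a Va] : V !=set0 by exact: infinite_setN0.
  have [b [Vb nba]] : (V `\` [set a]) !=set0.
    by apply: infinite_setN0; apply: infinite_setD.
  have [B [A [oB oA Bb Aa BA]]] := hausdorff_separate hY nba.
  have [fA|iA] := pselect (finite_set (V `&` A)).
    exists ([set a], V `\` [set a]); split=> //=.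
    - have -> : [set a] = (V `&` A) `\` ((V `&` A) `\` [set a]).
        apply/seteqP; split=> [_ -> //|x [VAx nx]].
          by split=> // -[_]; apply.
        by apply: contrapT => xa; apply: nx.
      by apply: open_setD_finite => //; [exact: openI|exact: finite_setD].
    - by exists a.
    - by move=> _ ->.
    - split=> //; first exact: open_setD_finite.
      + exact: infinite_setD.
      + by rewrite setDE setIC -setIA setICl setI0.
  exists (V `&` B, V `&` A); split=> //=; [exact: openI|by exists b|].
  split=> //; first exact: openI.
  by rewrite setIACA BA setI0.
have /choice[st stP] : forall V : set Y, exists OV : set Y * set Y,
    open V /\ infinite_set V -> [/\ open OV.1, OV.1 !=set0, OV.1 `<=` V &
      [/\ open OV.2, infinite_set OV.2, OV.2 `<=` V & OV.1 `&` OV.2 = set0]].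
  move=> V; have [[oV iV]|nV] := pselect (open V /\ infinite_set V).
    by have [OV OVP] := split_open V oV iV; exists OV.
  by exists (V, V) => /nV.
pose V := fix V n := if n is k.+1 then (st (V k)).2 else [set: Y].
have VP n : open (V n) /\ infinite_set (V n).
  elim: n => [|n IHn] /=; first by split=> //; exact: openT.
  by have [_ _ _ []] := stP _ IHn.
have VS m n : (m <= n)%N -> V n `<=` V m.
  move=> /subnKC <-; elim: (n - m)%N => [|k IHk]; first by rewrite addn0.
  rewrite addnS /= => x; have [_ _ _ [_ _ VV _]] := stP _ (VP (m + k)%N).
  by move=> /VV/IHk.
have lt_disj m n x : (m < n)%N -> (st (V m)).1 x -> (st (V n)).1 x -> False.
  move=> mn mx nx; have [_ _ OV _] := stP _ (VP n).
  have [_ _ _ [_ _ _]] := stP _ (VP m); rewrite -subset0; apply.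
  by split; [exact: mx|exact: (VS m.+1 n mn _ (OV _ nx))].
exists (fun n => (st (V n)).1); split=> [n|n|m n x mx nx].
- by have [] := stP _ (VP n).
- by have [] := stP _ (VP n).
- by have [/lt_disj/(_ mx nx)[]|/lt_disj/(_ nx mx)[]|] := ltngtP m n.
Qed.

Lemma ex_threshold (R : realType) (C : set R) : countable C ->
  exists t : R, (0 < t < 1)%R /\ ~ C t.
Proof.
move=> cC; apply: contrapT => /forallNP nt.
have : (lebesgue_measure `]0%R, 1%R[%classic <= lebesgue_measure C)%E.
  apply: le_measure; rewrite ?inE; [exact: measurable_itv|exact: countable_measurable|].
  move=> t; rewrite /= in_itv /= => t01; apply: contrapT => nCt.
  by apply: (nt t); split.
rewrite (countable_lebesgue_measure0 cC) lebesgue_measure_itv /= lte_fin ltr01.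
by rewrite oppr0 adde0 lee_fin ler10.
Qed.

(** Continuous functions separating the points [e n], cut at thresholds that the sequence never
    takes, code these points continuously by branches. The Cantor embedding makes this a real
    sequence, whose discreteness on [A] pulls back. *)
Lemma discrete_ultrafilter_space (R : realType) (q : set_system nat)
    (Y : topologicalType) (e : nat -> Y) :
  discrete_ultrafilter R q -> hausdorff_space Y -> completely_regular_space Y ->
  exists A, q A /\ discrete_set (e @` A).
Proof.
move=> [_ dq] hY crY.
have /choice[ht htP] : forall p : nat * nat, exists ht : (Y -> R) * R,
    [/\ continuous ht.1, forall n, ht.1 (e n) <> ht.2 &
     e p.1 <> e p.2 -> (ht.1 (e p.1) < ht.2 < ht.1 (e p.2))%R].
  move=> [i j] /=; have [eij|nij] := pselect (e i = e j).
    have [t [_ tP]] : exists t : R, (0 < t < 1)%R /\ ~ [set 0%R] t by apply: ex_threshold.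
    by exists (cst 0%R, t); split=> //= [x|_]; [exact: cvg_cst|move=> /esym].
  have cj : closed [set e j] by exact/accessible_closed_set1/hausdorff_accessible.
  have := crY (e i) [set e j] cj nij.
  move=> /(@uniform_separatorP _ R)[h [ch _ h0 h1]].
  have [|t [/andP[t0 t1] tP]] := @ex_threshold R (range (h \o e)).
    exact: card_image_le.
  exists (h, t); split=> //= [n hn|_]; first by apply: tP; exists n.
  have -> : h (e i) = 0%R by apply: h0; exists (e i).
  have -> : h (e j) = 1%R by apply: h1; exists (e j).
  by rewrite t0.
have [Phi [Phi_inj Phi_cont]] := ex_cantor_embedding R.
pose bits n : branch := fun k =>
  if unpickle k is Some p then ((ht p).2 < (ht p).1 (e n))%R else false.
have bits_inj m n : bits m = bits n -> e m = e n.
  move=> mn; apply: contrapT => nmn; have [_ _ /(_ nmn)/andP[ltm ltn]] := htP (m, n).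
  have := congr1 (@^~ (pickle (m, n))) mn.
  by rewrite /bits pickleK /= ltn (lt_gtF ltm).
have bits_open n N : exists U, [/\ open U, U (e n) &
    forall m, U (e m) -> forall k, (k < N)%N -> bits m k = bits n k].
  elim: N => [|N [U [oU Un UP]]]; first by exists setT; split=> //; exact: openT.
  have [V [oV Vn VP]] : exists V, [/\ open V, V (e n) &
      forall m, V (e m) -> bits m N = bits n N].
    rewrite /bits; case: (unpickle N) => [p|]; last by exists setT; split=> //; exact: openT.
    have [ch /(_ n)/eqP nt _] := htP p; have [lt|le] := ltP (ht p).2 ((ht p).1 (e n)).
      exists ((ht p).1 @^-1` [set x | (ht p).2 < x]%R); split=> //.
      by apply: open_comp; [move=> x _; exact: ch|exact: open_gt].
    exists ((ht p).1 @^-1` [set x | x < (ht p).2]%R); split=> //=.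
    - by apply: open_comp; [move=> x _; exact: ch|exact: open_lt].
    - by rewrite lt_neqAle nt.
    - by move=> m /ltW; rewrite leNgt => /negbTE.
  exists (U `&` V); split=> //; first exact: openI.
  move=> m [Um Vm] k; rewrite ltnS leq_eqVlt => /orP[/eqP ->|]; [exact: VP|exact: UP].
have [A [qA /discrete_setP dA]] := dq (Phi \o bits).
exists A; split=> //; apply/discrete_setP => _ [n An <-].
have [|V [oV Vn VP]] := dA (Phi (bits n)); first by exists n.
have /nbhs_ballP[r /= r0 rV] := open_nbhs_nbhs (conj oV Vn).
have [N NP] := Phi_cont (bits n) r r0.
have [U [oU Un UP]] := bits_open n N.
exists U; split=> // _ [m Am <-] /UP/NP mn; apply/bits_inj/Phi_inj/VP.
  by exists m.
by apply: rV; rewrite /ball /= distrC.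
Qed.

Lemma ultra_fmap (T U : Type) (f : T -> U) (F : set_system T) :
  UltraFilter F -> UltraFilter (f @ F).
Proof.
move=> FU; split=> [|G GP fG]; first exact: fmap_proper_filter.
apply/seteqP; split=> // A GA; apply: contrapT => /(ultra_setC FU) nA.
have /fG GnA : (f @ F) (~` A) by [].
by have [x [Ax nAx]] := filter_ex (filterI GA GnA).
Qed.

Lemma ultraI (T : Type) (F : set_system T) (A B : set T) :
  UltraFilter F -> F A -> F B -> F (A `&` B).
Proof. by move=> FU FA FB; exact: filterI. Qed.

Lemma cvg_closure (T : Type) (Y : topologicalType) (F : set_system T) (f : T -> Y)
    (A : set T) (x : Y) :
  UltraFilter F -> f @ F --> x -> F A -> closure (f @` A) x.
Proof.
move=> FU fx FA V /fx FV; have [t [At Vt]] := ultra_meet FU FA FV.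
by exists (f t); split=> //; exists t.
Qed.

Lemma closure_ultra (T : Type) (Y : topologicalType) (f : T -> Y) (y : Y) :
  closure (range f) y -> exists u, UltraFilter u /\ f @ u --> y.
Proof.
move=> fy; have PF : ProperFilter (filter_from (nbhs y) (fun V => f @^-1` V)).
  apply: filter_from_proper => [|V /fy[_ [[t _ <-] Vt]]]; last by exists t.
  apply: filter_from_filter; first by exists setT; exact: filterT.
  by move=> U V yU yV; exists (U `&` V) => //; exact: filterI.
have [u [uu Fu]] := ultraFilterLemma PF.
by exists u; split=> // V yV; apply: Fu; exists V.
Qed.

Lemma discrete_setS (X : topologicalType) (D E : set X) :
  E `<=` D -> discrete_set D -> discrete_set E.
Proof.
move=> ED /discrete_setP dD; apply/discrete_setP => x /ED/dD[U [oU Ux UP]].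
by exists U; split=> // y /ED; exact: UP.
Qed.

(* The point is the limit along a weak P-point [r], not below [q] in the
   Rudin-Keisler order, of a discrete sequence [d]. A nontrivial [q]-limit [e]
   may be assumed to lie in the range [D] of [d], or in [closure D `\` D], or off
   [closure D]. The first case exhibits [r] as an image of [q], the second
   contradicts [r] being a weak P-point, and in the third, where the range of [e]
   may be taken discrete, the two discrete sets have disjoint closures unless
   [d] accumulates to [e], which again makes [r] an image of [q]. *)
Lemma ex_trivial_limit_point (R : realType) (q : set_system nat)
    (Y : topologicalType) :
  discrete_ultrafilter R q -> hausdorff_space Y -> completely_regular_space Y ->
  infinite_compact_beta_omega_space Y ->
  exists x : Y, forall e : nat -> Y, e @ q --> x -> q [set n | e n = x].
Proof.
move=> dq hY crY [infY coY bY]; have qu : UltraFilter q by case: dq.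
have [r [ru rfin rRK rok]] := ex_ok_ultrafilter qu.
have [W [oO O0 Odisj]] := ex_cellular hY infY.
have /choice[c cP] : forall n, exists y, W n y by move=> n; exact: O0.
pose d (z : node) := c (pickle z); pose D := range d.
have dO z z' : W (pickle z) (d z') -> z' = z.
  by move=> /(Odisj _ _ _ (cP _))/(pcan_inj pickleK).
have disD : discrete_set D.
  apply/discrete_setP => _ [z _ <-]; exists (W (pickle z)); split=> //.
  by move=> _ [z' _ <-] /dO ->.
have cD : countable D by exact: sub_countable (card_image_le _ _) (countableP _).
have beta_d (B : set node) y : closure (d @` B) y -> closure (d @` (~` B)) y -> False.
  move=> yB ynB; have dB : d @` B `<=` D by move=> _ [z _ <-]; exists z.
  have := beta_omega_closures coY bY cD disD dB; rewrite -subset0; apply.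
  split; [exact: yB|apply: closureS ynB => _ [z nBz <-]].
  split; first by exists z.
  by move=> [z' Bz' e]; apply: nBz; rewrite -(dO z z')//  e; exact: cP.
have dru := ultra_fmap d ru.
move: (coY); rewrite compact_ultra => /(_ _ dru filterT)[x [_ dx]].
exists x => e ex; apply: contrapT => /(ultra_setC qu) nex.
have [qD|/(ultra_setC qu) qnD] := pselect (q [set n | D (e n)]).
  have /choice[phi phiP] : forall n, exists z : node, D (e n) -> d z = e n.
    move=> n; have [[z _ zn]|nD] := pselect (D (e n)); first by exists z.
    by exists (existT _ 0%N [ffun=> finset.set0]) => /nD.
  have [B [rB /(ultra_setC qu) qnB]] := rRK phi.
  apply: (beta_d B x); first exact: cvg_closure dx rB.
  have := cvg_closure qu ex (ultraI qu qD qnB); apply: closureS => _ [n [Dn nB] <-].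
  by exists (phi n) => //; exact: phiP.
have [qclD|/(ultra_setC qu) qnclD] := pselect (q [set n | closure D (e n)]).
  pose A := [set n | [/\ closure D (e n), ~ D (e n) & e n <> x]].
  have qA : q A by apply: filterS2 (ultraI qu qclD qnD) nex => n [].
  (* Each [e n] is the limit of [d] along some [u n], which differs from [r] since [e n] is not [x],
     and contains the cofinite sets since [e n] is not in [D]. *)
  have /choice[u uP] : forall n, exists u : set_system node,
      A n -> UltraFilter u /\ d @ u --> e n.
    move=> n; have [[clDn _ _]|nA] := pselect (A n); last by exists r.
    by have [u uP] := closure_ultra clDn; exists u.
  have [|B [rB uB]] := ok_point_weak_P (A := A) (u := u) ru rfin rok.
    move=> n An; have [un dun] := uP n An; case: (An) => _ nDn enx; split=> //.
      by move=> unr; apply: enx; apply: cvg_unique dx => //; rewrite -unr.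
    move=> B fB; apply: contrapT => /(ultra_setC un) unB; apply: nDn.
    have : closed (d @` (~` B)).
      apply: (accessible_finite_set_closed.1 _ _ (finite_image d fB)).
      exact: hausdorff_accessible.
    move=> /closure_id cl; have := cvg_closure un dun unB.
    by rewrite -cl => -[z _ <-]; exists z.
  apply: (beta_d B x); first exact: cvg_closure dx rB.
  apply: closureUS (cvg_closure qu ex qA) _ => _ [n An <-].
  have [un dun] := uP n An; apply: cvg_closure dun _.
  by apply: ultra_setC => //; exact: uB.
have [A0 [qA0 disA0]] := discrete_ultrafilter_space e dq hY crY.
pose A := A0 `&` [set n | ~ closure D (e n)]; pose E := e @` A.
have qA : q A by exact: filterI.
have disE : discrete_set E.
  by apply: discrete_setS disA0 => _ [n [An _] <-]; exists n.
have cE : countable E by exact: sub_countable (card_image_le _ _) (countableP _).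
have ED y : E y -> ~ closure D y by move=> [n [_ nD] <-].
have [rE|/(ultra_setC ru) rE] := pselect (r [set z | closure E (d z)]).
  (* [psi n] is the only possible index of a cellular set containing [e n]. A set [B] in [r] with
     preimage not in [q] splits [E] into two parts, both accumulating at [x]. *)
  have /choice[psi psiP] : forall n, exists z : node, forall z', W (pickle z') (e n) -> z' = z.
    move=> n; have [[z zn]|nz] := pselect (exists z : node, W (pickle z) (e n)).
      by exists z => z' z'n; exact: (pcan_inj pickleK (Odisj _ _ _ z'n zn)).
    by exists (existT _ 0%N [ffun=> finset.set0]) => z' z'n; case: nz; exists z'.
  have [B [rB /(ultra_setC qu) qnB]] := rRK psi.
  pose E1 := E `&` [set y | exists2 z : node, B z & W (pickle z) y].
  have E1E : E1 `<=` E by move=> y [].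
  have := beta_omega_closures coY bY cE disE E1E; rewrite -subset0; apply.
  split.
    apply: closureUS (cvg_closure ru dx (ultraI ru rB rE)) _ => _ [z [Bz Ez] <-] V zV.
    have zVO : nbhs (d z) (V `&` W (pickle z)).
      by apply: filterI => //; apply: open_nbhs_nbhs; split.
    have [y [Ey [Vy Oy]]] := Ez _ zVO.
    by exists y; split=> //; split=> //; exists z.
  apply: closureS (cvg_closure qu ex (ultraI qu qA qnB)) => _ [n [An nBn] <-].
  split; first by exists n.
  by move=> [_ [z Bz /psiP zn]]; apply: nBn; rewrite /= -zn.
(* The terms of [d] outside the closure of [E] form one discrete set with [E]; both parts accumulate
   at [x]. *)
pose D1 := [set z | ~ closure E (d z)].
have disDE : discrete_set (d @` D1 `|` E).
  apply/discrete_setP => y [[z D1z <-]|Ey].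
    exists (W (pickle z) `&` ~` closure E); split.
    - apply: openI => //; rewrite openC; exact: closed_closure.
    - by split=> //; exact: cP.
    - move=> y' [[z' _ <-]|Ey'] [+ nE]; first by move=> /dO ->.
      by case: nE; exact: subset_closure.
  have [U [oU Uy UP]] := (discrete_setP E).1 disE y Ey.
  exists (U `&` ~` closure D); split.
  - apply: openI => //; rewrite openC; exact: closed_closure.
  - by split=> //; exact: ED.
  - move=> y' [[z' _ <-]|Ey'] [Uy' nD]; last exact: UP.
    by case: nD; apply: subset_closure; exists z'.
have cDE : countable (d @` D1 `|` E).
  rewrite -bigcup2E; apply: bigcup_countable => // -[|[|]]//= _.
  exact: sub_countable (card_image_le _ _) (countableP _).
have := beta_omega_closures coY bY cDE disDE (@subsetUl _ _ _).
rewrite -subset0; apply; split; first exact: cvg_closure dx rE.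
apply: closureS (cvg_closure qu ex qA) => y Ey; split; first by right.
move=> [z _ zy]; apply: (ED y Ey); apply: subset_closure; rewrite -zy.
by exists z.
Qed.

(** * Products *)

Lemma beta_seq_inj (J : Type) (X : topologicalType) (z : J -> X) :
  beta_seq z -> injective z.
Proof.
move=> bz m n mn; apply: contrapT => nmn; have := bz [set m].
rewrite -subset0 => /(_ (z m)); apply; split; apply: subset_closure; first by exists m.
by exists n => // nm; apply: nmn.
Qed.

(** Each point [c] of the closure is adherent to the image of exactly one of [A] and its complement,
    so only one ultrafilter makes [z] converge to [c]; a continuous map is extended by its limits
    along these ultrafilters. *)
Lemma beta_seq_stone_cech (X : topologicalType) (z : nat -> X) :
  hausdorff_space X -> compact (closure (range z)) -> beta_seq z ->
  exists e : nat -> set_type (closure (range z)),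
    (forall n, set_val (e n) = z n) /\ is_stone_cech e.
Proof.
move=> hX coC bz; set C := closure (range z) in coC *.
have zC n : C (z n) by apply: subset_closure; exists n.
pose e n : set_type C := exist _ (z n) (mem_set (zC n)).
exists e; split=> //; split.
- split=> [m n mn|]; first exact: (beta_seq_inj bz (congr1 set_val mn)).
  apply/seteqP; split=> [U oU|U _]; last exact: discrete_open.
  exists (set_val @^-1` (~` closure (z @` (~` U)))).
    exists (~` closure (z @` (~` U))) => //.
    by rewrite openC; exact: closed_closure.
  apply/seteqP; split=> n /= Un.
    by apply: contrapT => nUn; apply: Un; apply: subset_closure; exists n.
  move=> nUn; have := bz U; rewrite -subset0; apply; split; last exact: nUn.
  by apply: subset_closure; exists n.
- move=> U [u Uu] [V oV VU]; have Vu : V (set_val u) by move: Uu; rewrite -VU.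
  have [_ [[n _ <-] Vn]] := set_valP u V (open_nbhs_nbhs (conj oV Vu)).
  by exists (e n); split; [rewrite -VU|exists n].
- rewrite compact_ultra => u uu _; have vu := ultra_fmap set_val uu.
  have uC : u (set_val @^-1` C).
    by apply: (@filterS _ _ _ setT _ _ filterT) => v _; exact: set_valP.
  move: coC; rewrite compact_ultra => /(_ _ vu uC)[p [Cp up]].
  exists (exist _ p (mem_set Cp)); split=> //= W.
  rewrite nbhsE => -[V' [[V oV <-] /= Vp] VW].
  apply: filterS VW _; exact: (up _ (open_nbhs_nbhs (conj oV Vp))).
- rewrite open_hausdorff => u v /eqP uv.
  have [|A [B [oA oB Au Bv AB]]] := @hausdorff_separate X (set_val u) (set_val v) hX.
    by move=> /val_inj.
  exists (set_val @^-1` A, set_val @^-1` B) => /=; first by rewrite !inE.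
  split; [by exists A|by exists B|].
  by apply/eqP; rewrite -preimage_setI AB preimage_set0.
move=> K f coK hK cf.
have /choice[u uP] : forall c : set_type C, exists u : set_system nat,
    UltraFilter u /\ z @ u --> set_val c.
  by move=> c; exact: closure_ultra (set_valP c).
have /choice[g gP] : forall c, exists y : K, f @ u c --> y.
  move=> c; have uc := (uP c).1; move: (coK); rewrite compact_ultra.
  by move=> /(_ _ (ultra_fmap f uc) filterT)[y [_ fy]]; exists y.
have uA c A : closure (z @` A) (set_val c) -> u c A.
  move=> cA; have [uc zc] := uP c; apply: contrapT => /(ultra_setC uc) nA.
  have := bz A; rewrite -subset0; apply; split; first exact: cA.
  exact: cvg_closure zc nA.
exists g; split=> [c W gW|n]; last first.
  have [un _] := uP (e n); have un1 : u (e n) [set n].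
    by apply: uA; apply: subset_closure; exists n.
  have un2 : u (e n) (f @^-1` [set f n]) by apply: filterS un1 => _ ->.
  have : closed [set f n] by exact/accessible_closed_set1/hausdorff_accessible.
  move=> /(closed_ultra_cvg (ultra_fmap f un) (gP (e n))); exact.
have [V Vg VW] : filter_from (nbhs (g c)) (@closure K) W.
  by apply: (compact_regular hK coK) => //; exact: filterT.
pose A := f @^-1` V; have cA : u c A by exact: (gP c _ Vg).
rewrite /= nbhs_simpl nbhsE.
exists (set_val @^-1` (~` closure (z @` (~` A)))); first split.
- exists (~` closure (z @` (~` A))) => //.
  by rewrite openC; exact: closed_closure.
- move=> cnA; have [uc zc] := uP c.
  by have [n []] := ultra_meet uc cA (uA _ _ cnA).
move=> c' /= nc'; apply: VW; have [uc' zc'] := uP c'.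
have uA' : u c' A.
  by apply: contrapT => /(ultra_setC uc') nA; apply: nc'; exact: cvg_closure zc' nA.
by apply: closureS (cvg_closure uc' (gP c') uA') => _ [n ? <-].
Qed.

(** * Tame points and subsequences *)

Lemma ultra_infinite (q : set_system nat) (A : set nat) :
  UltraFilter q -> nonprincipal q -> q A -> infinite_set A.
Proof.
move=> qu nq qA /finite_seqP[s sE]; subst A; elim: s qA => [|n s IHs] qs.
  by have [m] := filter_ex qs.
have [qn|/(ultra_setC qu) qn] := pselect (q [set n]); last first.
  apply: IHs; apply: filterS2 qs qn => m /=.
  by rewrite inE => /orP[/eqP ->|].
apply: (nq n); apply: (@max_filter _ _ (principal_filter_ultra n)).
by move=> B /principal_filterP Bn; apply: filterS qn => _ ->.
Qed.

(** Absence of copies of beta omega in [C], in terms of sequences: in a Hausdorff space, compactness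
    of [Q] makes the closure of the range compact and keeps it inside [C]. *)
Definition beta_free (X : topologicalType) (C : set X) : Prop :=
  forall (Q : set X) (z : nat -> X), compact Q -> Q `<=` C -> range z `<=` Q ->
    ~ beta_seq z.

Lemma beta_freeS (X : topologicalType) (C D : set X) :
  C `<=` D -> beta_free D -> beta_free C.
Proof. by move=> CD fD Q z coQ QC; apply: fD => //; exact: subset_trans CD. Qed.

Lemma beta_seq_comp (X : topologicalType) (z : nat -> X) (s : nat -> nat) :
  injective s -> beta_seq z -> beta_seq (z \o s).
Proof.
move=> si bz B; rewrite -subset0 -(bz (s @` B)); apply: setISS; apply: closureS.
  by move=> _ [n Bn <-]; exists (s n) => //; exists n.
by move=> _ [n nBn <-]; exists (s n) => // -[m Bm /si mn]; apply: nBn; rewrite -mn.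
Qed.

Lemma beta_free_setU_finite (X : topologicalType) (C F : set X) :
  hausdorff_space X -> closed C -> finite_set F -> beta_free C ->
  beta_free (C `|` F).
Proof.
move=> hX cC fF fC Q z coQ QCF zQ bz; have zi := beta_seq_inj bz.
have fz : finite_set (z @^-1` F) by apply: finite_preimage fF => m n _ _; exact: zi.
have [N NP] : exists N, forall n, F (z n) -> (n < N)%N.
  have /finite_seqP[s sE] := fz; exists (\max_(n <- s) n).+1 => n Fzn.
  have ns : n \in s by have : [set` s] n by rewrite -sE.
  by rewrite ltnS; exact: (@leq_bigmax_seq _ s xpredT id).
apply: (fC (Q `&` C) (z \o addn N)).
- exact: compact_closedI.
- by move=> x [].
- move=> _ [n _ <-] /=; have Qz : Q (z (N + n)%N) by apply: zQ; exists (N + n)%N.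
  by split=> //; have [//|/NP] := QCF _ Qz; rewrite ltnNge leq_addr.
- by apply: beta_seq_comp bz; exact: addnI.
Qed.

Lemma beta_free_finite (X : topologicalType) (F : set X) :
  finite_set F -> beta_free F.
Proof.
move=> fF Q z coQ QF zQ /beta_seq_inj zi.
have : finite_set (z @^-1` F) by apply: finite_preimage fF => m n _ _; exact: zi.
have -> : z @^-1` F = setT.
  by apply/seteqP; split=> // n _; apply/QF/zQ; exists n.
exact: infinite_nat.
Qed.

(** The property shared by suitable points of all three kinds of factors. Any infinite [B] inside
    [A] is allowed, so that countably many coordinates can be treated in turn. *)
Definition tame (q : set_system nat) (X : topologicalType) (x : X) : Prop :=
  forall w : nat -> X, w @ q --> x -> exists A, q A /\
    forall B, B `<=` A -> infinite_set B ->
      exists B', [/\ B' `<=` B, infinite_set B' & beta_free (closure (w @` B'))].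

Lemma tame_trivial_limits (q : set_system nat) (X : topologicalType) (x : X) :
  hausdorff_space X -> (forall w : nat -> X, w @ q --> x -> q [set n | w n = x]) ->
  tame q x.
Proof.
move=> hX triv w /triv qA; exists [set n | w n = x]; split=> // B BA infB.
exists B; split=> //; apply: (@beta_freeS _ _ [set x]); last exact: beta_free_finite.
rewrite (_ : [set x] = closure [set x]).
  by apply: closureS => _ [n /BA <- <-].
exact/closure_id/accessible_closed_set1/hausdorff_accessible.
Qed.

Lemma tame_weak_P_point (q : set_system nat) (X : topologicalType) (x : X) :
  UltraFilter q -> hausdorff_space X -> weak_P_point x -> tame q x.
Proof.
move=> qu hX wP; apply: tame_trivial_limits => // w wx; apply: contrapT.
move=> /(ultra_setC qu) nq; have := cvg_closure qu wx nq; apply: wP.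
  exact: sub_countable (card_image_le _ _) (countableP _).
by move=> _ [n wn <-].
Qed.

(** By regularity [w] stays, on a set in [q], in a neighbourhood whose closure lies in [U]; there
    closures in [U] and in [X] agree, and [beta_seq_stone_cech] turns a sequence into a copy of beta
    omega. *)
Lemma tame_sequentially_small (R : realType) (q : set_system nat)
    (X : topologicalType) (U : set X) (x : X) :
  UltraFilter q -> hausdorff_space X -> completely_regular_space X -> open U ->
  U x -> sequentially_small (set_type U) -> tame q x.
Proof.
move=> qu hX crX oU Ux ssU w wx.
have [V Vx VU] := @completely_regular_regular R X crX x U (open_nbhs_nbhs (conj oU Ux)).
exists (w @^-1` V); split=> [|B BV infB]; first exact: wx.
have cl_finite (F : set X) : finite_set F -> beta_free (closure F).
  move=> fF; have <- : F = closure F; last exact: beta_free_finite.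
  apply/closure_id; apply: (accessible_finite_set_closed.1 _ _ fF).
  exact: hausdorff_accessible.
have [fB|iB] := pselect (finite_set (w @` B)).
  by exists B; split=> //; exact: cl_finite.
pose WB : set (set_type U) := set_val @^-1` (w @` B).
have WBE : set_val @` WB = w @` B.
  apply/seteqP; split=> [_ [u Wu <-] //|y wy].
  have Uy : U y by case: wy => n Bn <-; apply/VU/subset_closure/BV.
  by exists (exist _ y (mem_set Uy)).
have infWB : infinite_set WB.
  by move=> /(finite_image set_val); rewrite WBE.
have [Z [ZW infZ nZ]] := ssU WB infWB.
pose B' := B `&` [set n | (set_val @` Z) (w n)].
have wB' : w @` B' = set_val @` Z.
  apply/seteqP; split=> [_ [n [_ Zn] <-] //|_ [u Zu <-]].
  have [n Bn nu] := ZW _ Zu; exists n; last exact: nu.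
  by split=> //=; rewrite nu; exists u.
have clU : closure (w @` B') `<=` U.
  by move=> y yB; apply: VU; apply: closureS yB => _ [n [/BV Vn _] <-].
exists B'; split=> [n []//||Q z coQ QB zQ bz].
  move=> /(finite_image w); rewrite wB' => fZ; apply: infZ.
  have si : {in set_val @^-1` (set_val @` Z) &, injective (@set_val _ U)}.
    by move=> u v _ _; exact: val_inj.
  by apply: sub_finite_set (finite_preimage si fZ) => u Zu; exists u.
have clQ : closure (range z) `<=` Q.
  by rewrite (closure_id Q).1; [exact: closureS|exact: compact_closed].
have coz : compact (closure (range z)).
  by apply: subclosed_compact coQ clQ; exact: closed_closure.
have [e [ez sc]] := beta_seq_stone_cech hX coz bz.
have CU (u : set_type (closure (range z))) : U (set_val u).
  by apply/clU/QB/clQ; exact: set_valP.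
pose h (u : set_type (closure (range z))) : set_type U :=
  exist _ (set_val u) (mem_set (CU u)).
apply: nZ; exists (set_type (closure (range z))), e, h; split=> //.
- split=> [u v uv|]; first by apply: val_inj; exact: (congr1 set_val uv).
  apply/seteqP; split=> [_ [G oG <-]|_ [_ [G oG <-] <-]]; last by exists G.
  by exists (set_val @^-1` G) => //; exists G.
- move=> _ [u _ <-] W; rewrite nbhsE => -[_ [[G oG <-] /= Ou] OW].
  have : closure (set_val @` Z) (set_val u).
    by rewrite -wB'; apply/QB/clQ; exact: set_valP.
  move=> /(_ G (open_nbhs_nbhs (conj oG Ou)))[_ [[v Zv <-] Ov]].
  by exists v; split=> //; exact: OW.
Qed.

Lemma ex_injection_in (C : nat -> set nat) : (forall n, infinite_set (C n)) ->
  exists s : nat -> nat, injective s /\ forall n, C n (s n).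
Proof.
move=> infC.
have /choice[p pP] : forall nm : nat * nat, exists m, C nm.1 m /\ (nm.2 < m)%N.
  move=> [n m] /=; have [k [Ck mk]] : (C n `\` `I_m.+1) !=set0.
    by apply/infinite_setN0/infinite_setD => //; exact: finite_II.
  by exists k; split=> //; rewrite ltnNge; apply/negP.
pose s := fix s n := if n is k.+1 then p (n, s k) else p (0%N, 0%N).
have sS n : (s n < s n.+1)%N by have [] := pP (n.+1, s n).
exists s; split=> [m n mn|[|n]]; last 2 first.
- by have [] := pP (0%N, 0%N).
- by have [] := pP (n.+1, s n).
have s_lt := homo_ltn ltn_trans sS.
by have [/s_lt|/s_lt|//] := ltngtP m n; rewrite mn ltnn.
Qed.

(** First an infinite [D] almost contained in every [A k] is chosen, which need not belong to [q].
    Tameness thins [D] out for one coordinate at a time, and a diagonal sequence is almost contained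
    in every stage. *)
Lemma ex_diagonal_subsequence (q : set_system nat) (X : nat -> topologicalType)
    (w : forall k, nat -> X k) (x : forall k, X k) :
  UltraFilter q -> nonprincipal q -> (forall k, hausdorff_space (X k)) ->
  (forall k, tame q (x k)) -> (forall k, w k @ q --> x k) ->
  exists s : nat -> nat,
    injective s /\ forall k, beta_free (closure (range (w k \o s))).
Proof.
move=> qu nq hX tx wx.
have /choice[A AP] : forall k, exists A, q A /\ forall B, B `<=` A -> infinite_set B ->
    exists B', [/\ B' `<=` B, infinite_set B' & beta_free (closure (w k @` B'))].
  by move=> k; exact: tx.
pose C k := [set n | forall j, (j <= k)%N -> A j n].
have qC k : q (C k).
  elim: k => [|k IHk].
    by apply: filterS (AP 0%N).1 => n An j; rewrite leqn0 => /eqP ->.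
  apply: filterS2 IHk (AP k.+1).1 => n Cn An j.
  by rewrite leq_eqVlt => /orP[/eqP ->//|]; exact: Cn.
have [t [t_inj tC]] := ex_injection_in (fun k => ultra_infinite qu nq (qC k)).
pose D := range t.
have infD : infinite_set D.
  move=> fD; have : finite_set (t @^-1` D) by apply: finite_preimage fD => m n _ _; exact: t_inj.
  have -> : t @^-1` D = setT by apply/seteqP; split=> // n _; exists n.
  exact: infinite_nat.
have DA k : finite_set (D `\` A k).
  apply: sub_finite_set (finite_image t (finite_II k)) => _ [[n _ <-] nA].
  by exists n => //=; rewrite ltnNge; apply/negP => kn; apply/nA/tC.
have /choice[st stP] : forall kB : nat * set nat, exists B',
    kB.2 `<=` D -> infinite_set kB.2 ->
    [/\ B' `<=` kB.2, infinite_set B' & beta_free (closure (w kB.1 @` B'))].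
  move=> [k B] /=; have [[BD iB]|nB] := pselect (B `<=` D /\ infinite_set B); last first.
    by exists B => ? ?; case: nB.
  have [||B' [B'B iB' fB']] := (AP k).2 (B `&` A k).
  - by move=> n [].
  - apply: sub_infinite_set (infinite_setD iB (DA k)) => n [Bn nDA]; split=> //.
    by apply: contrapT => nA; apply: nDA; split=> //; exact: BD.
  by exists B' => _ _; split=> // n /B'B[].
pose Bs := fix Bs n := if n is k.+1 then st (k, Bs k) else D.
have BsP n : Bs n `<=` D /\ infinite_set (Bs n).
  elim: n => [|n [BD iB]]; first by split.
  have [B'B iB' _] := stP (n, Bs n) BD iB.
  by split=> //; exact: subset_trans BD.
have BsS m n : (m <= n)%N -> Bs n `<=` Bs m.
  move=> /subnKC <-; elim: (n - m)%N => [|k IHk]; first by rewrite addn0.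
  have [BD iB] := BsP (m + k)%N; have [B'B _ _] := stP ((m + k)%N, Bs (m + k)%N) BD iB.
  by rewrite addnS; exact: subset_trans IHk.
have [s [s_inj sB]] := ex_injection_in (fun n => (BsP n).2).
exists s; split=> // k; have [BD iB] := BsP k.
have [_ _ fk] := stP (k, Bs k) BD iB.
have fF : finite_set ((w k \o s) @` `I_k.+1) by apply: finite_image; exact: finite_II.
apply: beta_freeS (beta_free_setU_finite (hX k) (@closed_closure _ _) fF fk).
have clU : closed (closure (w k @` Bs k.+1) `|` (w k \o s) @` `I_k.+1).
  apply: closedU; first exact: closed_closure.
  by apply: (accessible_finite_set_closed.1 _ _ fF); exact: hausdorff_accessible.
rewrite [X in _ `<=` X](closure_id _).1//; apply: closureS => _ [n _ <-] /=.
have [nk|kn] := leqP n k; first by right; exists n.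
by left; apply: subset_closure; exists (s n) => //; exact: BsS kn _ (sB n).
Qed.

(** * Changing one coordinate of a product *)

Lemma prod_continuous (T : topologicalType) (I : eqType) (X : I -> topologicalType)
    (h : T -> prod_topology X) :
  (forall i, continuous (fun t => h t i)) -> continuous h.
Proof.
move=> ch t; apply/cvg_sup => i V [_ [[W oW <-] Wt] WV].
exact: filterS WV (ch i t W (open_nbhs_nbhs (conj oW Wt))).
Qed.

Lemma prod_open_support (I : eqType) (X : I -> topologicalType)
    (V : set (prod_topology X)) (p : prod_topology X) :
  open V -> V p -> exists F : seq I, forall p' : prod_topology X,
    (forall i, i \in F -> p' i = p i) -> V p'.
Proof.
move=> oV Vp.
pose G : set_system (prod_topology X) := filter_from [set: seq I]
  (fun F => [set p' | forall i, i \in F -> p' i = p i]).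
have FG : Filter G.
  apply: filter_from_filter; first by exists [::].
  move=> F1 F2 _ _; exists (F1 ++ F2) => // p' e.
  by split=> i iF; apply: e; rewrite mem_cat iF ?orbT.
have Gp : G --> p.
  apply/cvg_sup => i W [_ [[W' oW <-] W'p] WW]; exists [:: i] => // p' e.
  by apply: WW; rewrite /= e ?mem_head.
by have [F _ FV] := Gp V (open_nbhs_nbhs (conj oV Vp)); exists F.
Qed.

Lemma not_homogeneous_prod (R : realType) (q : set_system nat) (I : eqType)
    (X : I -> topologicalType) (i0 : I) :
  discrete_ultrafilter R q -> nonprincipal q ->
  (forall i, completely_regular_space (X i)) ->
  (forall i, hausdorff_space (X i)) ->
  (forall i, exists x : X i, tame q x) ->
  infinite_compact_beta_omega_space (X i0) ->
  ~ homogeneous (prod_topology X).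
Proof.
move=> dq nq crX hX tX [infX coX bX] hom; have qu : UltraFilter q by case: dq.
have [W [oW W0 Wdisj]] := ex_cellular (@hX i0) infX.
have /choice[e eW] : forall n, exists y, W n y by move=> n; exact: W0.
have [y0 ey0] : exists y0 : X i0, e @ q --> y0.
  move: coX; rewrite compact_ultra => /(_ _ (ultra_fmap e qu) filterT)[y [_ ey]].
  by exists y.
have [x tx] : exists x : prod_topology X, forall i, tame q (x i).
  exists (fun i => projT1 (cid (tX i))) => i; exact: projT2 (cid (tX i)).
pose theta (y : X i0) : prod_topology X := dfwith x i0 y.
have ctheta : continuous theta by exact: dfwith_continuous.
have cproj i : continuous (fun p : prod_topology X => p i) by exact: proj_continuous.
have [f [[g [fK gK cf cg]] fx]] := hom (theta y0) x.
have supp n : exists F : seq I, forall p : prod_topology X,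
    (forall i, i \in F -> p i = f (theta (e n)) i) -> W n (g p i0).
  apply: (@prod_open_support _ _ [set p | W n (g p i0)]).
    apply: (@open_comp _ _ (fun p : prod_topology X => g p i0)) => // p _.
    exact: (continuous_comp (cg p) (cproj i0 _)).
  by rewrite /= fK /theta dfwithin.
have /choice[F FP] := supp.
have [c cF] : exists c : nat -> I, forall n i, i \in F n -> exists k, i = c k.
  exists (fun k => if unpickle k is Some (n, m) then nth i0 (F n) m else i0).
  move=> n i iF; exists (pickle (n, index i (F n))).
  by rewrite pickleK nth_index.
pose fc k (y : X i0) : X (c k) := f (theta y) (c k).
have cfc k : continuous (fc k).
  move=> y.
  exact: (continuous_comp (ctheta y) (continuous_comp (cf _) (cproj (c k) _))).
have fcx (k : nat) : (fc k \o e) @ q --> x (c k).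
  rewrite -fx; apply: cvg_comp ey0 _; exact: cfc.
have [s [s_inj sP]] := ex_diagonal_subsequence qu nq (fun k => @hX (c k))
  (fun k => tx (c k)) fcx.
pose d (z : node) := e (s (pickle z)).
have [|P [a [b [Pa Pb ab]]]] :=
    @ex_coordinatewise_equal _ _ fc d coX (fun k => @hX (c k)) cfc.
  move=> k z zd; apply: (sP k (fc k @` closure (range d))) => //.
    apply: continuous_compact; first exact: continuous_subspaceT.
    by apply: subclosed_compact coX _ => //; exact: closed_closure.
  move=> _ [y dy <-] V yV; have [_ [[t _ <-] Vt]] := dy _ (cfc k y V yV).
  by exists (fc k (d t)); split=> //; exists (pickle t).
(* The neighbourhoods [W n] only see countably many coordinates through [g], so
   all others can be made constant. *)
pose m (p : prod_topology X) : prod_topology X :=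
  fun i => if pselect (exists k, i = c k) then p i else x i.
have cm : continuous m.
  apply: prod_continuous => i; rewrite /m; case: pselect => ci; first exact: cproj.
  exact: (@cst_continuous (prod_topology X) (X i) (x i)).
pose G y := g (m (f (theta y))) i0.
have cG : continuous G.
  move=> y; exact: (continuous_comp (ctheta y) (continuous_comp (cf _)
    (continuous_comp (cm _) (continuous_comp (cg _) (cproj i0 _))))).
have GW z : W (s (pickle z)) (G (d z)).
  apply: FP => i iF; rewrite /m; case: pselect => // -[].
  exact: cF iF.
have Gab : G a = G b.
  congr (g _ i0); apply/functional_extensionality_dep => i; rewrite /m.
  case: pselect => // ci /=; have [k ->] := ci; exact: ab.
pose D := range (G \o d).
have GWeq z z' : W (s (pickle z)) (G (d z')) -> z' = z.
  by move=> /(Wdisj _ _ _ (GW z'))/s_inj/(pcan_inj pickleK).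
have disD : discrete_set D.
  apply/discrete_setP => _ [z _ <-]; exists (W (s (pickle z))); split=> //.
  by move=> _ [z' _ <-] /GWeq ->.
have cD : countable D by exact: sub_countable (card_image_le _ _) (countableP _).
have PD : (G \o d) @` P `<=` D by move=> _ [z _ <-]; exists z.
have Gcl (A : set node) u : closure (d @` A) u -> closure ((G \o d) @` A) (G u).
  move=> du V uV; have [_ [[z Az <-] Vz]] := du _ (cG u V uV).
  by exists (G (d z)); split=> //; exists z.
(* The common value of [G] at [a] and [b] is adherent to two complementary parts of the discrete set
   [D]. *)
have := beta_omega_closures coX bX cD disD PD; rewrite -subset0; apply.
split; first exact: (Gcl _ _ Pa).
rewrite Gab; apply: closureS (Gcl _ _ Pb) => _ [z nPz <-]; split; first by exists z.
move=> [z' Pz' zz']; apply: nPz; rewrite -(GWeq z z')//.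
by rewrite -[G (d z')]/((G \o d) z') zz'; exact: GW.
Qed.

Theorem theorem5 (R : realType)
  (hp : exists p : set_system nat, nonprincipal p /\ discrete_ultrafilter R p)
  (I : Type) (X : I -> topologicalType)
  (hcr : forall i, completely_regular_space (X i))
  (hT2 : forall i, hausdorff_space (X i))
  (hX : forall i, infinite_compact_beta_omega_space (X i) \/
                  (exists x : X i, weak_P_point x) \/
                  has_sequentially_small_open (X i))
  (hbw : exists i, infinite_compact_beta_omega_space (X i)) :
  ~ homogeneous (prod_topology X).
Proof.
have [q [nq dq]] := hp; have qu : UltraFilter q by case: dq.
have [i0 Xi0] := hbw.
have tX i : exists x : X i, tame q x.
  have [bX|[[x wP]|[U [oU [x Ux] ssU]]]] := hX i.
  - have [x xP] := ex_trivial_limit_point dq (@hT2 i) (@hcr i) bX.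
    by exists x; exact: tame_trivial_limits.
  - by exists x; exact: tame_weak_P_point.
  - by exists x; exact: (tame_sequentially_small R qu (@hT2 i) (@hcr i) oU Ux).
(* [Peq] gives the index type a decidable equality, which the change of a single coordinate
   requires. *)
move: X i0 hcr hT2 {hX hbw} tX Xi0; elim/Peq: I => I X i0 hcr hT2 tX Xi0.
exact: (not_homogeneous_prod dq nq hcr hT2 tX Xi0).
Qed.
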